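(* The joint distribution of the pre-first observed passage time $\tau_{\nu-1}$ and the crossing level $A_\nu$ of the process is, for integers $r\ge 0$ and real $t\ge 0$, $$\begin{aligned} P\{A_\nu=r,\ \tau_{\nu-1}>t\}={}&\frac{\mu}{\lambda}\,\frac{a\mu}{\mu+\lambda}\left[\frac{\mu+\lambda}{a\mu}R_{0r}+\sum_{j=1}^{M-1}R_{jr}\right]-\frac{\mu}{\mu+\lambda}\left[G_0R_{0r}+\sum_{j=1}^{M-1}(G_j-H_{j-1})R_{jr}\right]\\ &-\frac{\mu}{\lambda}\Bigg[\sum_{j=0}^{M-1}\sum_{i=0}^{M-1-j}c^i\mathbf{1}_{\{r=i+j\}}-(b+c)\sum_{j=0}^{M-2}\sum_{i=0}^{M-2-j}c^i\mathbf{1}_{\{r=i+j+1\}}+bc\sum_{j=0}^{M-3}\sum_{i=0}^{M-3-j}c^i\mathbf{1}_{\{r=i+j+2\}}\Bigg]\\ &+\frac{\mu}{\mu+\lambda}\Bigg[\sum_{j=0}^{M-1}G_j\sum_{i=0}^{M-1-j}c^i\mathbf{1}_{\{r=i+j\}}-\sum_{j=0}^{M-2}(bG_j+H_j)\sum_{i=0}^{M-2-j}c^i\mathbf{1}_{\{r=i+j+1\}}\\ &\qquad\qquad+b\sum_{j=0}^{M-3}H_j\sum_{i=0}^{M-3-j}c^i\mathbf{1}_{\{r=i+j+2\}}\Bigg], \end{aligned}$$ where $c=\dfrac{b\mu+\lambda}{\mu+\lambda}$, $$R_{jr}=\begin{cases}0,& r<j\\ 1,& r=j\\ (c-b)c^{r-j-1},&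 r>j,\end{cases}$$ and $$G_j=b^j\sum_{k=0}^j\binom{j}{k}\left(\frac{a}{b}\right)^k\left[P(k,\lambda t)+\frac{\mu}{\lambda}P(k+1,\lambda t)\right],$$ $$H_j=b^{j+1}\sum_{k=0}^j\binom{j}{k}\left(\frac{a}{b}\right)^k\left[P(k,\lambda t)+\left(\frac{\mu}{\lambda}+\frac{a}{b}\right)P(k+1,\lambda t)\right].$$
   Context: $A(t)$, $t\ge 0$, is a marked (compound) Poisson process: $A(t)=\sum_{k}a_k\mathbf{1}_{\{t_k\le t\}}$, where $\{t_k\}$ are the points of a Poisson process on $\mathbb{R}_+$ of intensity $\lambda>0$ and the marks $a_k$ are i.i.d., independent of $\{t_k\}$, geometrically distributed with parameter $a$, so that with $b=1-a$ their common probability generating function is $g(z)=\frac{az}{1-bz}$. The process is observed at the times of a renewal process $\{\tau_n:n=0,1,2,\dots\}$, independent of the filtration to which $A(t)$ is adapted, with $\tau_0=0$, $A(\tau_0)=0$, and inter-observation times $\Delta_n=\tau_n-\tau_{n-1}$, $n\ge 1$, exponentially distributed with parameter $\mu$ (common Laplace–Stieltjes transform $\frac{\mu}{\mu+z}$). Put $A_n=A(\tau_n)$ for $n\ge 0$. For a fixed positive integer $M$ (the threshold), the exit index is $\nu=\inf\{n=0,1,2,\dots:A_n>M\}$, and $\tau_\nu$ is the first observed crossing time. $P(k,z)=1-\frac{\Gamma(k,z)}{\Gamma(k)}$ denotes the lower regularized gamma function ($\Gamma(k,z)$ is the upper incomplete gamma function), with $P(0,z)=1$. Sums whose upper limit is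 smaller than their lower limit are zero.
   Formalization: The exit index is taken as ν = inf{n : A_n ≥ M} instead of A_n > M; with A_n > M the printed formula fails (M = 1, r = 1, t = 0: left side 0, right side positive). The formula itself is unchanged, with 0 < a < 1. *)

(* Defs.v *)
From HB Require Import structures.
From mathcomp Require Export all_boot all_order all_algebra.
From mathcomp Require Export all_classical all_reals all_analysis.
From mathcomp Require Export measurable_realfun.

Export Order.TTheory GRing.Theory Num.Theory.
Export numFieldNormedType.Exports.

#[export] Set Implicit Arguments.
#[export] Unset Strict Implicit.
#[export] Unset Printing Implicit Defensive.

Local Open Scope classical_set_scope.
Local Open Scope ring_scope.

Section Independence.
Context (d : measure_display) (T : measurableType d) (R : realType)
        (P : probability T R).

Definition independent_events (E : nat -> set T) : Prop :=
  forall J : seq nat, uniq J ->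
    P (\bigcap_(k in [set` J]) E k) = (\prod_(k <- J) P (E k))%E.

Definition independent_RVs (d' : measure_display) (T' : measurableType d')
    (X : nat -> T -> T') : Prop :=
  forall B : nat -> set T', (forall k, measurable (B k)) ->
    independent_events (fun k => X k @^-1` B k).

Definition independent_systems (G H : set (set T)) : Prop :=
  forall A B, G A -> H B -> P (A `&` B) = (P A * P B)%E.

Definition sigma_generated (d' : measure_display) (T' : measurableType d')
    (X : nat -> T -> T') : set (set T) :=
  <<s \bigcup_k preimage_set_system [set: T] (X k) measurable >>.

End Independence.

Section MarkedPoisson.
Context (d : measure_display) (T : measurableType d) (R : realType)
        (P : probability T R).

(* Number of points falling in B, possibly +oo. *)
Definition point_count (p : nat -> T -> R) (B : set R) (w : T) : \bar R :=
  (\sum_(0 <= k <oo) (\1_B (p k w))%:E)%E.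

(* The points are enumerated in nondecreasing order, and the counting process
   starts from 0, i.e. no point sits at the origin. *)
Definition poisson_process (lambda : R) (p : nat -> T -> R) : Prop :=
  [/\ forall k w, 0 < p k w,
      forall k w, p k w <= p k.+1 w,
      forall s u n, 0 <= s -> s < u ->
        P [set w | point_count p `]s, u] w = n%:R%:E]
          = (poisson_pmf (lambda * (u - s)) n)%:E &
      forall (s : nat -> R) (n : nat -> nat),
        0 <= s 0%N -> (forall k, s k <= s k.+1) ->
        independent_events P
          (fun k => [set w | point_count p `]s k, s k.+1] w = (n k)%:R%:E])].

(* Geometric law on {1, 2, ...}, i.e. generating function az / (1 - (1-a)z). *)
Definition geometric_law (a : R) (X : T -> nat) : Prop :=
  forall n, P [set w | X w = n.+1] = (a * (1 - a) ^+ n)%:E.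

Definition marked_process (p : nat -> T -> R) (mark : nat -> T -> nat)
    (s : R) (w : T) : \bar R :=
  (\sum_(0 <= k <oo) ((mark k w)%:R * \1_`]-oo, s] (p k w))%:E)%E.

Definition marked_poisson_process (lambda a : R) (p : nat -> {RV P >-> R})
    (mark : nat -> {RV P >-> nat}) : Prop :=
  [/\ poisson_process lambda (fun k => p k : T -> R),
      independent_RVs P (fun k => mark k : T -> nat),
      forall k, geometric_law a (mark k) &
      independent_systems P (sigma_generated (fun k => mark k : T -> nat))
        (sigma_generated (fun k => p k : T -> R))].

Definition filtration (F : R -> set (set T)) : Prop :=
  [/\ forall s, 0 <= s -> sigma_algebra [set: T] (F s),
      forall s, 0 <= s -> F s `<=` measurable &
      forall s u, 0 <= s -> s <= u -> F s `<=` F u].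

Definition adapted (F : R -> set (set T)) (A : R -> T -> \bar R) : Prop :=
  forall s, 0 <= s -> forall B : set (\bar R), measurable B -> F s (A s @^-1` B).

(* A renewal process started at 0 with exponential(mu) gaps. *)
Definition exponential_renewal (mu : R) (tau : nat -> {RV P >-> R}) : Prop :=
  let Delta n w := tau n.+1 w - tau n w in
  [/\ forall w, tau 0%N w = 0,
      independent_RVs P Delta &
      forall n B, measurable B -> P (Delta n @^-1` B) = exponential_prob mu B].

(* inf {n | X_n >= M}, with value +oo if M is never reached. The threshold
   counts as crossed when it is attained: the formulas below are those of the
   convention X_n >= M; the convention X_n > M amounts to replacing M by M + 1
   in them. *)
Definition exit_index (X : nat -> T -> \bar R) (M : nat) (w : T) : \bar R :=
  ereal_inf [set n%:R%:E | n in [set n | (M%:R%:E <= X n w)%E]].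

(* {X_nu = r, tau_(nu-1) > t}. *)
Definition exit_event (X : nat -> T -> \bar R) (tau : nat -> T -> R) (M r : nat)
    (t : R) : set T :=
  [set w | exists n : nat, [/\ exit_index X M w = n%:R%:E,
                               X n w = r%:R%:E & t < tau n.-1 w]].

End MarkedPoisson.

Section Formula.
Context (R : realType).

(* Gamma(k, z), for k >= 1 *)
Definition upper_gamma (k : nat) (z : R) : R :=
  Rintegral lebesgue_measure `[z, +oo[ (fun x : R => x ^+ k.-1 * expR (- x)).

Definition reg_lower_gamma (k : nat) (z : R) : R :=
  if k is 0%N then 1 else 1 - upper_gamma k z / upper_gamma k 0.

Definition coef_c (lambda mu a : R) : R :=
  ((1 - a) * mu + lambda) / (mu + lambda).

Definition coef_R (lambda mu a : R) (j r : nat) : R :=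
  let b := 1 - a in let c := coef_c lambda mu a in
  if (r < j)%N then 0
  else if r == j then 1
  else (c - b) * c ^+ (r - j - 1)%N.

Definition coef_G (lambda mu a t : R) (j : nat) : R :=
  let b := 1 - a in
  b ^+ j * \sum_(0 <= k < j.+1) 'C(j, k)%:R * (a / b) ^+ k *
    (reg_lower_gamma k (lambda * t)
     + mu / lambda * reg_lower_gamma k.+1 (lambda * t)).

Definition coef_H (lambda mu a t : R) (j : nat) : R :=
  let b := 1 - a in
  b ^+ j.+1 * \sum_(0 <= k < j.+1) 'C(j, k)%:R * (a / b) ^+ k *
    (reg_lower_gamma k (lambda * t)
     + (mu / lambda + a / b) * reg_lower_gamma k.+1 (lambda * t)).

End Formula.

(* Main.v *)
From HB Require Import structures.
From mathcomp Require Import ring lra zify.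
Require Import Defs.
Local Open Scope classical_set_scope.
Local Open Scope ring_scope.

(** Write q_s for the law of A(s). Up to a null set A(tau_n) is nondecreasing in
    n, so the exit happens at index n + 1 with A_nu = r >= M exactly when
    A(tau_n) = j for some j < M and A(tau_(n+1)) = r. Since A has independent
    stationary increments and is independent of the observation times, and since
    Delta_(n+1) is independent of tau_n,

      P(A(tau_n) = j, A(tau_(n+1)) = r, tau_n > t)
        = E[q_(tau_n)(j); tau_n > t] * E[q_Delta(r - j)].

    Summing over n replaces the law of tau_n by the renewal measure of the
    exponential renewal process, which is mu times Lebesgue measure, because the
    Erlang densities of tau_1, tau_2, ... add up to the constant mu. Hence, for
    r >= M,

      P(A_nu = r, tau_(nu-1) > t)
        = sum_(j < M) occupation t j * gap_pmf (r - j),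

    where occupation t j = mu * int_t^oo q_s(j) ds and gap_pmf m = E q_Delta(m)
    (exit_event_prob). The index n = 0 contributes nothing because tau_0 = 0.

    Both factors are explicit. Given n Poisson points, A is a sum of n geometric
    marks and has the negative binomial law; integrating Poisson weights over
    [t, oo[ gives incomplete gamma values, hence the combinations
    G_j - H_(j-1) (occupationS), and gap_pmf m is mu / (mu + lambda) times the
    coefficient of z^m in (1 - b z) / (1 - c z), that is R_0m
    (gap_pmf_coef_R).

    The bracketed double sums of the formula are truncations at degree M - 1 of
    power series in z. They vanish for r >= M; for r < M they cancel the first
    two terms, as they must since A_nu >= M (passage_small).

    Three points of measure theory carry the first part. ge0_integral_freeze
    integrates out one of two independent variables. To apply it to the
    process at random times, A(s, w) must be jointly measurable in s and w for
    the sigma-algebra generated by the filtration: this holds because every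
    path is constant on some interval to the right of each s, so
    that A(s) <= x if and only if A(q) <= x for a rational q > s
    (measurable_graph_downset). Finally, free_of records independence of an event
    from the members of an independent sequence in a form that survives
    conditioning on successive members, and so allows inductions along partial
    sums, for the observation times as well as for the marks. *)

(** * Independence, densities and translations in integrals *)

Section freeze.
Local Open Scope ereal_scope.
Context d d1 d2 (T : measurableType d) (T1 : measurableType d1)
  (T2 : measurableType d2) (R : realType).
Variables (Q : {finite_measure set T -> \bar R}) (X : T -> T1) (Y : T -> T2).
Hypotheses (mX : measurable_fun setT X) (mY : measurable_fun setT Y).
Variable m2 : {sigma_finite_measure set T2 -> \bar R}.
Hypothesis indep : forall B C, measurable B -> measurable C ->
  Q (X @^-1` B `&` Y @^-1` C) = Q (X @^-1` B) * m2 C.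

Let law := pushforward Q X.

Let law0 : law set0 = 0. Proof. exact: measure0. Qed.

Let law_ge0 A : 0 <= law A. Proof. exact: measure_ge0. Qed.

Let law_sigma_additive : semi_sigma_additive law.
Proof. exact: measure_semi_sigma_additive. Qed.

HB.instance Definition _ := isMeasure.Build _ _ _ law
  law0 law_ge0 law_sigma_additive.

Let law_fin : fin_num_fun law.
Proof.
move=> A mA; rewrite /law /pushforward fin_num_measure//.
by rewrite -[_ @^-1` _]setTI; exact: mX.
Qed.

HB.instance Definition _ := Measure_isFinite.Build _ _ _ law law_fin.

(** When Y is independent of X with law m2, the joint law of (X, Y) under Q is a
    product measure, so Y can be integrated out with X held fixed. The measure Q
    is only finite, which allows restrictions of a probability to an event, and
    m2 is given separately from Q so that it keeps total mass 1 there. *)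
Lemma ge0_integral_freeze (f : T1 * T2 -> \bar R) :
  measurable_fun setT f -> (forall z, 0 <= f z) ->
  \int[Q]_w f (X w, Y w) = \int[Q]_w \int[m2]_y f (X w, y).
Proof.
move=> mf f0.
pose XY w := (X w, Y w).
have mXY : measurable_fun setT XY by exact: measurable_fun_pair.
have prodE B : measurable B -> (law \x m2) B = pushforward Q XY B.
  by apply: product_measure_unique => {}B C mB mC; exact: indep.
rewrite (_ : \int[Q]_w f (X w, Y w) = \int[pushforward Q XY]_z f z); last first.
  by rewrite ge0_integral_pushforward.
transitivity (\int[law \x m2]_z f z).
  by apply: eq_measure_integral => A mA _; apply/esym; exact: prodE.
rewrite fubini_tonelli1// ge0_integral_pushforward//.
- exact: measurable_fun_fubini_tonelli_F.
- by move=> x _; apply: integral_ge0.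
Qed.

End freeze.

Section density.
Local Open Scope ereal_scope.
Context d (T : measurableType d) (R : realType).
Variables (mu nu : {measure set T -> \bar R}) (p : T -> R).
Hypotheses (mp : measurable_fun setT p) (p0 : forall x, (0 <= p x)%R).
Hypothesis nuE : forall B, measurable B -> nu B = \int[mu]_(x in B) (p x)%:E.
Import HBNNSimple.

(** Both sides agree on indicators by nuE, and then on all nonnegative functions by
    monotone approximation. *)
Lemma ge0_integral_density (f : T -> \bar R) :
  measurable_fun setT f -> (forall x, 0 <= f x) ->
  \int[nu]_x f x = \int[mu]_x (f x * (p x)%:E).
Proof.
move=> mf f0.
pose h := nnsfun_approx measurableT mf.
have mh n : measurable_fun setT (EFin \o h n) by exact/measurable_EFinP.
have ndh x : {homo (fun n => (EFin \o h n) x) : a b / (a <= b)%N >-> a <= b}.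
  by move=> a b ab; rewrite lee_fin; exact/lefP/nd_nnsfun_approx.
have hf x : (EFin \o h n) x @[n --> \oo] --> f x.
  by exact: cvg_nnsfun_approx.
have mp' : measurable_fun setT (EFin \o p) by exact/measurable_EFinP.
transitivity (limn (fun n => \int[nu]_x (EFin \o h n) x)).
  rewrite -monotone_convergence//; last by move=> n x _; rewrite lee_fin.
  by apply: eq_integral => x _; exact/esym/cvg_lim.
transitivity (limn (fun n => \int[mu]_x ((EFin \o h n) x * (p x)%:E))); last first.
  rewrite -monotone_convergence//.
  - by apply: eq_integral => x _; apply/cvg_lim => //; exact: cvgeZr.
  - by move=> n; exact: emeasurable_funM.
  - by move=> n x _; rewrite mule_ge0 ?lee_fin.
  - by move=> x _ a b ab; rewrite lee_wpmul2r ?lee_fin// -lee_fin; exact: ndh.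
congr (limn _); apply/funext => n.
transitivity (\int[nu]_x
   (\sum_(y \in range (h n)) (y * \1_(h n @^-1` [set y]) x)%:E)).
  by apply: eq_integral => x _; rewrite /= fimfunE -fsumEFin.
have indich r : measurable_fun setT (fun x => (r * \1_(h n @^-1` [set r]) x)%:E).
  by apply/measurable_EFinP; exact: measurable_funM.
rewrite ge0_integral_fsum//; last by move=> y x _; exact: nnfun_muleindic_ge0.
transitivity (\int[mu]_x (\sum_(y \in range (h n))
    (y * \1_(h n @^-1` [set y]) x)%:E * (p x)%:E)); last first.
  apply: eq_integral => x _.
  rewrite -ge0_mule_fsuml => [|y]; last exact: nnfun_muleindic_ge0.
  by rewrite fsumEFin// -fimfunE.
rewrite ge0_integral_fsum//; last 2 first.
  - by move=> y; exact: emeasurable_funM.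
  - by move=> y x _; rewrite mule_ge0 ?lee_fin//; exact: nnfun_muleindic_ge0.
apply: eq_fsbigr => r rhn.
under [LHS]eq_integral do rewrite EFinM.
rewrite integralZl_indic_nnsfun//.
under [RHS]eq_integral do rewrite EFinM -muleA.
rewrite ge0_integralZl//.
- rewrite integral_indic// setIT nuE// integral_mkcond; congr (_ * _).
  by apply: eq_integral => x xE; rewrite muleC epatch_indic.
- by apply: emeasurable_funM => //; exact/measurable_EFinP.
- by move=> x _; rewrite mule_ge0 ?lee_fin.
- by move: rhn; rewrite inE => -[x _ <-]; rewrite lee_fin.
Qed.

End density.

Lemma lebesgue_measure_shift (R : realType) (s : R) (A : set R) : measurable A ->
  pushforward (@lebesgue_measure R) (+%R s : _ -> measurableTypeR R) A
  = lebesgue_measure A.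
Proof.
move=> mA; apply/esym/lebesgue_measure_unique => //=.
  exact: measurable_funD.
move=> _ _ [[a b]] _ <-.
rewrite /pushforward (_ : _ @^-1` _ = `](a - s), (b - s)]%classic).
  rewrite !lebesgue_measure_itv/= !lte_fin ltrD2r; case: ifP => // _.
  by rewrite -!EFinB opprB addrA subrK.
by apply/seteqP; split => x /=; rewrite !in_itv/= ltrBlDl lerBrDl.
Qed.

Lemma ge0_integral_shift (R : realType) (s : R) (f : R -> \bar R) :
  measurable_fun setT f -> (forall x, 0 <= f x)%E ->
  (\int[lebesgue_measure]_x f (s + x)%R = \int[lebesgue_measure]_x f x)%E.
Proof.
move=> mf f0.
have ms : measurable_fun setT (+%R s : measurableTypeR R -> measurableTypeR R).
  exact: measurable_funD.
transitivity (\int[pushforward (@lebesgue_measure R)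
    (+%R s : _ -> measurableTypeR R)]_x f x)%E.
  by rewrite ge0_integral_pushforward.
by apply: eq_measure_integral => A mA _; exact: lebesgue_measure_shift.
Qed.

(** Finite additivity for events F v indexed by the value v of some quantity, hence
    pairwise disjoint. *)
Lemma measure_ord_bigcup (d : measure_display) (T : measurableType d)
  (R : realType) (P : {measure set T -> \bar R}) (N : nat) (F : nat -> set T) :
  (forall v, measurable (F v)) -> (forall u v w, F u w -> F v w -> u = v) ->
  (P [set w | exists2 v, (v < N)%N & F v w] = \sum_(v < N) P (F v))%E.
Proof.
move=> mF Finj.
rewrite -(@measure_bigsetU_ord _ _ _ P N predT (F \o val)); [|by move=> i; exact: mF|].
  by rewrite -(bigcup_mkord N F); congr (P _); apply/seteqP; split => w [v ? ?]; exists v.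
by move=> i j _ _ [w [Fi Fj]]; apply: val_inj; exact: Finj Fi Fj.
Qed.

Lemma measurable_sum_eq (d : measure_display) (T : measurableType d)
  (X : nat -> T -> nat) n l v : (forall k B, measurable (X k @^-1` B)) ->
  measurable [set w | (\sum_(n <= k < n + l) X k w)%N = v].
Proof.
move=> mX; elim: l v => [|l IH] v.
  under eq_set do rewrite addn0 big_geq//.
  by have [->|v0] := eqVneq v 0%N; [rewrite (_ : [set _ | _] = setT)//|
    rewrite (_ : [set _ | _] = set0)//];
    apply/seteqP; split => // w /= /esym/eqP; rewrite (negbTE v0).
rewrite (_ : [set w | _] = \bigcup_(u in [set u | (u < v.+1)%N])
    (X (n + l)%N @^-1` [set u] `&`
     [set w | (\sum_(n <= k < n + l) X k w)%N = (v - u)%N])).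
  by apply: bigcup_measurable => u _; exact: measurableI.
apply/seteqP; split => w /=.
  rewrite addnS big_nat_recr ?leq_addr//= => Sm; exists (X (n + l)%N w) => /=.
    by rewrite ltnS -Sm leq_addl.
  by split => //; rewrite -Sm addnK.
move=> [u /= uv [Xu S]].
by rewrite addnS big_nat_recr ?leq_addr//= S Xu subnK.
Qed.

(** The sigma-algebra is kept as a type of its own, distinct from that of T, in
    order to read membership in a generated sigma-algebra as measurability. *)
Lemma measurable_generated (d : measure_display) (T : measurableType d)
  (d' : measure_display) (T' : measurableType d') (X : nat -> T -> T') k :
  measurable_fun [set: g_sigma_algebraType
    (\bigcup_k preimage_set_system [set: T] (X k) measurable)] (X k).
Proof. by move=> _ B mB; apply: sub_sigma_algebra; exists k => //; exists B. Qed.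

Section almost_sure.
Context (d : measure_display) (T : measurableType d) (R : realType)
  (P : probability T R).

Lemma measureI_null (G X : set T) : measurable G -> measurable X ->
  P (~` G) = 0%E -> P (X `&` G) = P X.
Proof.
move=> mG mX G0; rewrite [RHS](measureDI P mX mG).
rewrite [X in _ = (X + _)%E](_ : _ = 0%E) ?add0e//.
have mXG : measurable (X `\` G) by exact: measurableD.
have mGC : measurable (~` G) by exact: measurableC.
by apply: (subset_measure0 mXG mGC _ G0) => w [].
Qed.

Lemma bigcap_null (G : nat -> set T) : (forall k, measurable (G k)) ->
  (forall k, P (~` G k) = 0%E) -> P (~` \bigcap_k G k) = 0%E.
Proof.
move=> mG G0; have mGC k : measurable (~` G k) by exact: measurableC.
rewrite setC_bigcap; apply: measure_negligible; first exact: bigcup_measurable.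
apply: negligible_bigcup => k; apply/(@negligibleP _ _ _ P _ (mGC k)).
exact: G0.
Qed.

End almost_sure.

(** * Poisson weights and the incomplete gamma function *)

Section poisson_weight.
Context (R : realType) (l : R).
Hypothesis l0 : 0 < l.
Local Notation leb := (@lebesgue_measure R).

(** The Poisson weight with parameter l * s, as a function of s that is smooth
    everywhere, in particular at s = 0. *)
Definition pois (k : nat) (s : R) : R := (l * s) ^+ k / k`!%:R * expR (- (l * s)).

Lemma pois_ge0 k s : 0 <= s -> 0 <= pois k s.
Proof.
move=> s0; rewrite /pois.
by rewrite !mulr_ge0 ?expR_ge0 ?invr_ge0 ?exprn_ge0 ?mulr_ge0 ?ler0n ?(ltW l0).
Qed.

Lemma measurable_pois k : measurable_fun setT (pois k).
Proof.
apply: measurable_funM.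
  apply: measurable_funM => //; apply: measurable_funX; exact: measurable_funM.
by apply: measurableT_comp => //; apply: measurableT_comp => //; exact: measurable_funM.
Qed.

Lemma pois_pmf k s : 0 < s -> poisson_pmf (l * s) k = pois k s.
Proof. by move=> s0; rewrite /poisson_pmf mulr_gt0. Qed.

Lemma is_derive_pois k (x : R) :
  is_derive x 1 (pois k) (l * ((if k is j.+1 then pois j x else 0) - pois k x)).
Proof.
have pE : pois k = k`!%:R^-1 \*: ((l \*: id) ^+ k * (expR \o (- l \*: id))).
  apply/funext => s; rewrite /pois !fctE /GRing.scale/=.
  by rewrite -[RHS]/(_ * (_ * expR (- l * s))) mulNr mulrA [_^-1 * _]mulrC.
rewrite [X in is_derive _ _ X _]pE.
apply: is_derive_eq.
rewrite /pois /GRing.scale/=.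
rewrite [in expR _](_ : - l *: x = - (l * x)); last exact: mulNr.
rewrite [in _ ^+ k.-1](_ : l *: x = l * x)// {pE}.
have E m : ((l \*: (@id R)) ^+ m) x = (l * x) ^+ m by elim: m => // m IH; rewrite !exprS -IH.
case: k => [|k]; rewrite ?E.
  rewrite expr0 fact0; ring.
have k0 : k.+1%:R != 0 :> R by rewrite pnatr_eq0.
have f0 : k`!%:R != 0 :> R by rewrite pnatr_eq0 -lt0n fact_gt0.
rewrite factS natrM exprS /=; field.
by rewrite f0 nat1r k0.
Qed.

(** The derivatives l * (pois (i - 1) - pois i) telescope. *)
Lemma is_derive_pois_tail k (x : R) :
  is_derive x 1 (fun s => - \sum_(i < k.+1) pois i s) (l * pois k x).
Proof.
elim: k => [|k IH].
  rewrite (_ : (fun s => _) = - pois 0); last by apply/funext => s; rewrite big_ord1.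
  have D := is_derive_pois 0 x.
  by apply: is_derive_eq; ring.
rewrite (_ : (fun s => _) = (fun s => - \sum_(i < k.+1) pois i s) - pois k.+1); last first.
  by apply/funext => s; rewrite big_ord_recr/= opprD.
have D := is_derive_pois k.+1 x.
by apply: is_derive_eq => /=; ring.
Qed.

(** From x^(k+1) / (k+1)! <= e^x: the weight is at most (k + 1) / (l s). *)
Lemma cvg_pois_oo k : pois k x @[x --> +oo%R] --> (0 : R).
Proof.
have le x : 0 < x -> pois k x <= (k.+1%:R / l) * x^-1.
  move=> x0; have lx := mulr_gt0 l0 x0.
  have := expR_ge1Dxn k (ltW lx).
  rewrite /pois expRN => H.
  rewrite ler_pdivrMr ?expR_gt0// -[leRHS]mulrA.
  have : (l * x) ^+ k.+1 / k.+1`!%:R <= expR (l * x).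
    by apply: le_trans H; rewrite lerDr.
  move=> {}H; apply: le_trans (_ : k.+1%:R / l * (x^-1 * ((l * x) ^+ k.+1 / k.+1`!%:R)) <= _).
    rewrite exprS factS natrM invfM.
    have k0 : k.+1%:R != 0 :> R by rewrite pnatr_eq0.
    have f0 : k`!%:R != 0 :> R by rewrite pnatr_eq0 -lt0n fact_gt0.
    by rewrite le_eqVlt; apply/orP; left; apply/eqP; field; rewrite ?k0 ?f0 ?gt_eqF.
  by rewrite ler_wpM2l ?divr_ge0 ?(ltW l0)// ler_wpM2l ?invr_ge0 ?(ltW x0).
apply: (@squeeze_cvgr _ _ _ _ (fun=> 0) (fun x => (k.+1%:R / l) * x^-1)).
- near=> x; have x0 : 0 < x by near: x; exact: nbhs_pinfty_gt.
  by rewrite le// pois_ge0// ltW.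
- exact: cvg_cst.
- rewrite -[X in _ --> X](mulr0 (k.+1%:R / l)); apply: cvgM; first exact: cvg_cst.
  apply/gtr0_cvgV0; last exact: cvg_id.
  by near=> x; near: x; exact: nbhs_pinfty_gt.
Unshelve. all: by end_near. Qed.

Lemma integral_pois k (t : R) : 0 <= t ->
  (\int[leb]_(s in `[t, +oo[) (pois k s)%:E =
   (l^-1 * \sum_(i < k.+1) pois i t)%:E)%E.
Proof.
move=> t0.
have cF j : continuous (pois j).
  move=> x; have D := is_derive_pois j x.
  exact/differentiable_continuous/derivable1_diffP/ex_derive.
pose F := l^-1 \*: (fun s => - \sum_(i < k.+1) pois i s).
have dF (x : R) : is_derive x 1 F (pois k x).
  have D := is_derive_pois_tail k x.
  apply: is_derive_eq; rewrite /GRing.scale/= mulrA mulVf ?mul1r// gt_eqF//.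
rewrite (@ge0_continuous_FTC2y _ _ F _ 0).
- by rewrite sub0e /F/= /GRing.scale/= mulrN opprK.
- by move=> x tx; apply: pois_ge0; exact: le_trans tx.
- exact: continuous_subspaceT.
- rewrite -[X in _ --> X](scaler0 _ l^-1); apply: cvgZr.
  rewrite -[X in _ --> X](@oppr0 R); apply: cvgN.
  rewrite (_ : (fun s => \sum_(i < k.+1) pois i s) = \sum_(i < k.+1) pois i); last first.
    by apply/funext => s; rewrite fct_sumE.
  elim/big_ind : _ => [|f g f0 g0|i _]; first exact: cvg_cst.
    by rewrite -[X in _ --> X](addr0 (0 : R)); exact: cvgD.
  exact: cvg_pois_oo.
- by move=> x _; exact: ex_derive.
- apply: cvg_at_right_filter; have D := dF t.
  exact/differentiable_continuous/derivable1_diffP/ex_derive.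
- by move=> x _; rewrite derive1E derive_val.
Qed.

End poisson_weight.

Lemma upper_gammaE (R : realType) k (z : R) : 0 <= z ->
  upper_gamma k.+1 z = k`!%:R * \sum_(i < k.+1) pois 1 i z.
Proof.
move=> z0; rewrite /upper_gamma /Rintegral.
rewrite (_ : (\int[_]_(x in _) _)%E =
  (\int[lebesgue_measure]_(x in `[z, +oo[) (k`!%:R%:E * (pois 1 k x)%:E))%E); last first.
  apply: eq_integral => x _; rewrite -EFinM /pois mul1r mulrA; congr (_ * _)%:E.
  by rewrite mulrCA mulfV ?mulr1// pnatr_eq0 -lt0n fact_gt0.
rewrite ge0_integralZl//; last 2 first.
- by apply/measurable_EFinP/measurable_funTS; exact: measurable_pois.
- move=> x /=; rewrite in_itv/= andbT => zx; rewrite lee_fin pois_ge0//.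
  exact: le_trans zx.
by rewrite integral_pois// invr1 mul1r.
Qed.

(** Erlang-Poisson duality: the incomplete gamma function at an integer is a Poisson
    distribution function. The integration variable can be rescaled by l because
    only the product l * t enters the weights. *)
Lemma reg_lower_gammaE (R : realType) k (l t : R) : 0 < l -> 0 <= t ->
  reg_lower_gamma k.+1 (l * t) = 1 - \sum_(i < k.+1) pois l i t.
Proof.
move=> l0 t0; rewrite /reg_lower_gamma !upper_gammaE// ?mulr_ge0 ?(ltW l0)//.
have f0 : k`!%:R != 0 :> R by rewrite pnatr_eq0 -lt0n fact_gt0.
rewrite [X in _ / (_ * X)](_ : _ = 1); last first.
  rewrite big_ord_recl big1 ?addr0; last first.
    by move=> i _; rewrite /pois mulr0 expr0n/= !mul0r.
  by rewrite /pois mulr0 oppr0 expR0 expr0 fact0 divr1 mulr1.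
rewrite mulr1 mulrAC mulfV// mul1r; congr (_ - _).
by apply: eq_bigr => i _; rewrite /pois mul1r.
Qed.

(** * Erlang densities and the renewal measure *)

Section erlang.
Context (R : realType) (mu : R).
Hypothesis mu0 : 0 < mu.
Local Notation leb := (@lebesgue_measure R).

(** The density of the sum of n + 1 independent exponential variables; the shift
    by one avoids the Dirac mass at n = 0. *)
Definition erlang_pdf (n : nat) : R -> R :=
  (fun u => mu * pois mu n u) \_ `[0, +oo[.

Definition expo_step (f : R -> \bar R) (s : R) : \bar R :=
  (\int[exponential_prob mu]_x f (s + x)%R)%E.

(** The expectation of f(tau_n), obtained by integrating out the last gap first. *)
Fixpoint renewal_mean (n : nat) (f : R -> \bar R) : \bar R :=
  if n is m.+1 then renewal_mean m (expo_step f) else f 0.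

Lemma erlang_pdf_ge0 n u : 0 <= erlang_pdf n u.
Proof.
rewrite /erlang_pdf patchE; case: ifPn => // /[!inE]/=; rewrite in_itv/= andbT => u0.
by rewrite mulr_ge0 ?(ltW mu0) ?pois_ge0.
Qed.

Lemma measurable_erlang_pdf n : measurable_fun setT (erlang_pdf n).
Proof.
apply/measurable_restrict => //; rewrite setTI; apply: measurable_funTS.
by apply: measurable_funM => //; exact: measurable_pois.
Qed.

Lemma erlang_pdf0 : erlang_pdf 0 = exponential_pdf mu.
Proof.
apply/funext => u; rewrite /erlang_pdf /exponential_pdf !patchE; case: ifP => // _.
by rewrite /pois expr0 fact0 divr1 mul1r mulNr.
Qed.

Lemma expo_stepE (f : R -> \bar R) (s : R) :
  measurable_fun setT f -> (forall x, 0 <= f x)%E ->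
  expo_step f s = (\int[leb]_u (f u * (exponential_pdf mu (u - s))%:E))%E.
Proof.
move=> mf f0; rewrite /expo_step.
have mfs : measurable_fun setT (fun x => f (s + x)).
  by apply: measurableT_comp => //; exact: measurable_funD.
have pdf0 x : 0 <= exponential_pdf mu x by apply: exponential_pdf_ge0; exact: ltW.
have pdfE B : measurable B -> exponential_prob mu B =
  (\int[leb]_(x in B) (exponential_pdf mu x)%:E)%E by [].
rewrite (@ge0_integral_density _ (measurableTypeR R) R leb (exponential_prob mu)
  (exponential_pdf mu) (@measurable_exponential_pdf R mu) pdf0 pdfE _ mfs
  (fun x => f0 _)); last exact: mu0.
rewrite -[RHS](@ge0_integral_shift _ s); last 2 first.
- apply: emeasurable_funM => //; apply/measurable_EFinP.
  apply: measurableT_comp; first exact: measurable_exponential_pdf.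
  exact: measurable_funB.
- by move=> x; rewrite mule_ge0// lee_fin; apply: exponential_pdf_ge0; exact: ltW.
by under [RHS]eq_integral do rewrite addrAC subrr add0r.
Qed.

Lemma expo_step_ge0 (f : R -> \bar R) (s : R) :
  (forall x, 0 <= f x)%E -> (0 <= expo_step f s)%E.
Proof. by move=> f0; apply: integral_ge0. Qed.

Let measurable_exp_kernel :
  measurable_fun setT (fun z : R * R => exponential_pdf mu (z.2 - z.1)).
Proof.
apply: measurableT_comp; first exact: measurable_exponential_pdf.
exact: measurable_funB.
Qed.

Lemma measurable_expo_step (f : R -> \bar R) :
  measurable_fun setT f -> (forall x, 0 <= f x)%E ->
  measurable_fun setT (expo_step f).
Proof.
move=> mf f0; rewrite (_ : expo_step f = fun s =>
  (\int[leb]_u (f u * (exponential_pdf mu (u - s))%:E))%E); last first.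
  by apply/funext => s; exact: expo_stepE.
apply: (@measurable_fun_fubini_tonelli_F _ _ _ _ _ leb
  (fun z : R * R => f z.2 * (exponential_pdf mu (z.2 - z.1))%:E)%E).
- apply: emeasurable_funM => /=; first exact: measurableT_comp.
  exact/measurable_EFinP.
- by move=> z; rewrite mule_ge0// lee_fin; apply: exponential_pdf_ge0; exact: ltW.
Qed.

Lemma integral_exprn (n : nat) (u : R) : 0 <= u ->
  (\int[leb]_(s in `[0%R, u]) (s ^+ n)%:E = (u ^+ n.+1 / n.+1%:R)%:E)%E.
Proof.
rewrite le_eqVlt => /predU1P[<-|u0].
  by rewrite set_itv1 integral_set1 expr0n mul0r.
have dF (x : R) : is_derive x 1 (fun s => s ^+ n.+1 / n.+1%:R) (x ^+ n).
  rewrite (_ : (fun s => _) = n.+1%:R^-1 \*: ((@id R) ^+ n.+1)); last first.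
    by apply/funext => s; rewrite fctE/= mulrC.
  apply: is_derive_eq; rewrite /GRing.scale/= mulr1 mulrA mulVf ?mul1r//.
have cF : continuous (fun s : R => s ^+ n.+1 / n.+1%:R).
  by move=> x; exact/differentiable_continuous/derivable1_diffP/ex_derive.
rewrite (@continuous_FTC2 _ _ (fun s => s ^+ n.+1 / n.+1%:R))//=.
- by rewrite expr0n/= mul0r sube0.
- by apply: continuous_subspaceT => x; exact: exprn_continuous.
- split => /=.
  + by move=> x _; exact: ex_derive.
  + by apply: cvg_at_right_filter; exact: cF.
  + by apply: cvg_at_left_filter; exact: cF.
- by move=> x _; rewrite derive1E derive_val.
Qed.

(** For 0 <= s <= u the exponential factors combine to exp(- mu u), which leaves the
    integral of a power of s. *)
Lemma erlang_convolution n u :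
  (\int[leb]_s ((exponential_pdf mu (u - s))%:E * (erlang_pdf n s)%:E) =
   (erlang_pdf n.+1 u)%:E)%E.
Proof.
have [u0|u0] := ltP u 0.
  rewrite integral0_eq; last first.
    move=> s _; rewrite /erlang_pdf patchE; case: ifPn => [|_]; last by rewrite mule0.
    rewrite inE/= in_itv/= andbT => s0.
    by rewrite lt0_exponential_pdf ?mul0e//; lra.
  rewrite /erlang_pdf patchE ifN// notin_setE/= in_itv/= andbT.
  by apply/negP; rewrite -ltNge.
rewrite (_ : (\int[leb]_s _)%E = (\int[leb]_(s in `[0%R, u])
    ((mu ^+ n.+2 / n`!%:R * expR (- (mu * u)))%:E * (s ^+ n)%:E))%E); last first.
  rewrite [RHS]integral_mkcond; apply: eq_integral => s _.
  rewrite /erlang_pdf !patchE !mem_setE !in_itv/= andbT.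
  have [s0|s0]/= := leP 0 s; last by rewrite mule0.
  have [su|su] := leP s u; last by rewrite lt0_exponential_pdf ?mul0e//; lra.
  rewrite exponential_pdfE ?subr_ge0// -!EFinM /pois; congr (_%:E).
  rewrite (_ : - (mu * u) = - mu * (u - s) + - (mu * s)); last by ring.
  by rewrite expRD exprMn !exprS; ring.
rewrite ge0_integralZl//; last 3 first.
- by apply/measurable_EFinP; exact: measurable_funX.
- by move=> s /=; rewrite in_itv/= => /andP[s0 _]; rewrite lee_fin exprn_ge0.
- rewrite lee_fin mulr_ge0 ?expR_ge0// divr_ge0 ?exprn_ge0 ?ler0n//. exact: ltW.
rewrite integral_exprn// -EFinM /erlang_pdf patchE mem_setE in_itv/= u0/=.
congr (_%:E); rewrite /pois factS natrM exprMn !exprS.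
have k0 : n.+1%:R != 0 :> R by rewrite pnatr_eq0.
have f0 : n`!%:R != 0 :> R by rewrite pnatr_eq0 -lt0n fact_gt0.
by field; rewrite f0 nat1r k0.
Qed.

Lemma renewal_meanS n (f : R -> \bar R) :
  measurable_fun setT f -> (forall x, 0 <= f x)%E ->
  renewal_mean n.+1 f = (\int[leb]_u (f u * (erlang_pdf n u)%:E))%E.
Proof.
elim: n f => [|n IH] f mf f0.
  rewrite /= expo_stepE// erlang_pdf0.
  by under eq_integral do rewrite subr0.
rewrite -[LHS]/(renewal_mean n.+1 (expo_step f)) IH; last 2 first.
- exact: measurable_expo_step.
- by move=> x; exact: expo_step_ge0.
have e0 x : (0 <= (exponential_pdf mu x)%:E)%E.
  by rewrite lee_fin; apply: exponential_pdf_ge0; exact: ltW.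
have r0 m x : (0 <= (erlang_pdf m x)%:E)%E by rewrite lee_fin erlang_pdf_ge0.
pose h (z : R * R) := (f z.2 * (exponential_pdf mu (z.2 - z.1))%:E * (erlang_pdf n z.1)%:E)%E.
have mh : measurable_fun setT h.
  apply: emeasurable_funM; last first.
    apply/measurable_EFinP; apply: measurableT_comp => //.
    exact: measurable_erlang_pdf.
  apply: emeasurable_funM; first exact: measurableT_comp.
  by apply/measurable_EFinP; exact: measurable_exp_kernel.
have h0 z : (0 <= h z)%E by rewrite !mule_ge0 ?f0 ?e0 ?r0.
have mexp (s : R) : measurable_fun setT (fun u : R => exponential_pdf mu (u - s)).
  apply: measurableT_comp; first exact: measurable_exponential_pdf.
  exact: measurable_funB.
have mfe (s : R) : measurable_fun setT
    (fun u : R => f u * (exponential_pdf mu (u - s))%:E)%E.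
  by apply: emeasurable_funM => //; apply/measurable_EFinP; exact: mexp.
have mer (u : R) : measurable_fun setT
    (fun s : R => (exponential_pdf mu (u - s))%:E * (erlang_pdf n s)%:E)%E.
  apply: emeasurable_funM; apply/measurable_EFinP; last exact: measurable_erlang_pdf.
  apply: measurableT_comp; first exact: measurable_exponential_pdf.
  exact: measurable_funB.
transitivity (\int[leb]_s \int[leb]_u h (s, u))%E.
  apply: eq_integral => s _; rewrite expo_stepE// -ge0_integralZr//.
  - exact: mfe.
  - by move=> x _; rewrite mule_ge0 ?f0 ?e0 ?r0.
rewrite (@fubini_tonelli _ _ _ _ _ leb leb h mh h0).
apply: eq_integral => u _; rewrite -erlang_convolution -ge0_integralZl//.
- by apply: eq_integral => s _; rewrite /h/= muleA.
- exact: mer.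
- by move=> s _; rewrite mule_ge0 ?f0 ?e0 ?r0.
Qed.

(** The weights pois n u form a probability in n. *)
Lemma erlang_sum u : 0 <= u -> (\sum_(0 <= n <oo) (erlang_pdf n u)%:E = mu%:E)%E.
Proof.
move=> u0; apply/cvg_lim => //.
rewrite (_ : (fun n => \sum_(0 <= i < n) _)%E = EFin \o
  (fun n => (mu * expR (- (mu * u))) * series (exp_coeff (mu * u)) n)); last first.
  apply/funext => n /=; rewrite sumEFin; congr (_%:E).
  rewrite /series/= big_distrr/=; apply: eq_bigr => i _.
  rewrite /erlang_pdf patchE mem_setE in_itv/= u0/= /pois /exp_coeff/=; ring.
apply: cvg_EFin; first exact: nearW.
rewrite [X in _ --> X](_ : mu = mu * expR (- (mu * u)) * expR (mu * u)); last first.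
  by rewrite -mulrA -expRD addNr expR0 mulr1.
by apply: cvgM; [exact: cvg_cst|exact: is_cvg_series_exp_coeff].
Qed.

(** Exchange sum and integral: the densities of the observation times add up to the
    constant mu on the half line. *)
Lemma renewal_measure (g : R -> R) : measurable_fun setT g -> (forall x, 0 <= g x) ->
  (\sum_(0 <= n <oo) renewal_mean n.+1 (EFin \o g) =
   mu%:E * \int[leb]_(u in `[0%R, +oo[) (g u)%:E)%E.
Proof.
move=> mg g0.
have mf : measurable_fun setT (EFin \o g) by exact/measurable_EFinP.
have f0 x : (0 <= (g x)%:E)%E by rewrite lee_fin.
have r0 m x : (0 <= (erlang_pdf m x)%:E)%E by rewrite lee_fin erlang_pdf_ge0.
under eq_eseriesr do rewrite renewal_meanS//.
rewrite -integral_nneseries//; last 2 first.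
- move=> n; apply: emeasurable_funM => //; apply/measurable_EFinP.
  exact: measurable_erlang_pdf.
- by move=> n x _; rewrite mule_ge0 ?f0 ?r0.
rewrite -ge0_integralZl//; last 2 first.
- exact: measurable_funTS.
- by rewrite lee_fin ltW.
rewrite [RHS]integral_mkcond; apply: eq_integral => u _.
rewrite nneseriesZl; last by move=> n _; exact: r0.
rewrite patchE mem_setE in_itv/= andbT; case: ifPn => u0.
  by rewrite erlang_sum// muleC.
rewrite eseries0 ?mule0// => n _ _.
by rewrite /erlang_pdf patchE mem_setE in_itv/= andbT (negbTE u0).
Qed.

End erlang.

(** * Events independent of members of a sequence *)

Section free_of.
Context (d : measure_display) (T : measurableType d) (R : realType)
  (P : probability T R) (d' : measure_display) (T' : measurableType d').
Variable X : nat -> {mfun T >-> T'}.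

(** Independence of E from finite families of the X k, k in K, stated for all
    conditions at once, so that some of them can be moved into E (free_ofI). *)
Definition free_of (K : pred nat) (E : set T) : Prop :=
  forall B : nat -> set T', (forall k, measurable (B k)) ->
  forall J : seq nat, uniq J -> {subset J <= K} ->
  (P (E `&` \bigcap_(k in [set` J]) (X k @^-1` B k)) =
   P E * \prod_(k <- J) P (X k @^-1` B k))%E.

Lemma free_of_setT (K : pred nat) : independent_RVs P (fun k => X k : T -> T') ->
  free_of K setT.
Proof.
by move=> iX B mB J uJ _; rewrite setTI probability_setT mul1e; exact: iX.
Qed.

Lemma free_of_sub (K K' : pred nat) E : {subset K' <= K} -> free_of K E -> free_of K' E.
Proof. by move=> KK' fE B mB J uJ JK; apply: fE => // k /JK /KK'. Qed.

Lemma free_of1 (K : pred nat) E k C : free_of K E -> k \in K -> measurable C ->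
  P (E `&` X k @^-1` C) = (P E * P (X k @^-1` C))%E.
Proof.
move=> fE kK mC; have := fE (fun=> C) (fun=> mC) [:: k] isT.
rewrite big_seq1 set_cons1 bigcap_set1; apply.
by move=> j; rewrite inE => /eqP ->.
Qed.

(** Conditioning on the value of X k uses up the index k only: this is what
    makes inductions along partial sums possible. *)
Lemma free_ofI (K : pred nat) E k C : free_of K E -> k \in K -> measurable C ->
  free_of [pred j | K j && (j != k)] (E `&` X k @^-1` C).
Proof.
move=> fE kK mC B mB J uJ JK; rewrite (free_of1 fE kK mC).
(* Insert the additional condition on X k into the family. *)
pose B' j := if j == k then C else B j.
have kJ : k \notin J by apply/negP => /JK; rewrite inE eqxx andbF.
have B'k : B' k = C by rewrite /B' eqxx.
have JB' : \bigcap_(j in [set` J]) (X j @^-1` B' j) = \bigcap_(j in [set` J]) (X j @^-1` B j).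
  by apply: eq_bigcapr => j /= jJ; rewrite /B'; case: eqP => // jk; rewrite -jk jJ in kJ.
have kJE : [set` k :: J] = k |` [set` J].
  by apply/seteqP; split => j /=; rewrite inE => /predU1P.
have := fE B' _ (k :: J); rewrite big_cons muleA kJE bigcap_setU1 JB' B'k setIA => ->.
- congr (_ * _)%E; apply: eq_big_seq => j jJ.
  by rewrite /B'; case: eqP => // jk; rewrite -jk jJ in kJ.
- by move=> j; rewrite /B'; case: ifP.
- by rewrite /= kJ.
- by move=> j; rewrite inE => /predU1P[->//|/JK]; rewrite inE => /andP[].
Qed.

End free_of.

Lemma free_of_bigcap (d : measure_display) (T : measurableType d) (R : realType)
  (P : probability T R) (d' : measure_display) (T' : measurableType d')
  (X : nat -> {mfun T >-> T'}) (K : pred nat) E (B : nat -> set T') J :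
  free_of P X K E -> (forall k, measurable (B k)) -> uniq J -> {subset J <= K} ->
  free_of P X [pred k | K k && (k \notin J)]
    (E `&` \bigcap_(k in [set` J]) (X k @^-1` B k)).
Proof.
move=> fE mB; elim: J E K fE => [|k J IH] E K fE.
  move=> _ _; rewrite (_ : [set` [::]] = set0); last by apply/seteqP; split.
  by rewrite bigcap_set0 setIT; apply: free_of_sub fE => k /andP[].
rewrite [uniq _]/= => /andP[kJ uJ] JK.
have kJE : [set` k :: J] = k |` [set` J].
  by apply/seteqP; split => j /=; rewrite inE => /predU1P.
rewrite kJE bigcap_setU1 setIA.
have fEk := free_ofI fE (JK _ (mem_head _ _)) (mB k).
apply: free_of_sub (IH _ _ fEk uJ _) => j /=.
  by rewrite !inE negb_or => /andP[Kj /andP[jk jJ]]; rewrite jk jJ !andbT.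
move=> jJ; apply/andP; split; first by apply: JK; rewrite inE jJ orbT.
by apply: contraNneq kJ => <-.
Qed.

(** * Laws of the observation times *)

Definition expo_probability (R : realType) (mu : R) (mu0 : 0 < mu) :
  probability (measurableTypeR R) R.
Proof. by unshelve refine (exponential_prob mu : probability _ _). Defined.

Section renewal.
Context (d : measure_display) (T : measurableType d) (R : realType)
  (P : probability T R) (mu : R) (tau : nat -> {RV P >-> R}).
Hypotheses (mu0 : 0 < mu) (rtau : exponential_renewal mu tau).

Let D (n : nat) : {mfun T >-> R} := [the {mfun T >-> R} of tau n.+1 \- tau n].

(** By induction on n. The last gap is independent of tau_n on the event E, since
    the induction hypothesis can be applied to E and to E intersected with any
    event on that gap. *)
Lemma renewal_law n E (mE : measurable E) (f : R -> \bar R) :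
  free_of P D (fun k => (k < n)%N) E ->
  measurable_fun setT f -> (forall x, 0 <= f x)%E ->
  (\int[mrestr P mE]_w f (tau n w) = P E * renewal_mean mu n f)%E.
Proof.
have [tau0 iD lD] := rtau.
elim: n E mE f => [|n IH] E mE f fE mf f0.
  under eq_integral do rewrite tau0.
  by rewrite integral_cst//= /mrestr setTI muleC.
have fEn : free_of P D (fun k => (k < n)%N) E.
  by apply: free_of_sub fE => k; exact: ltnW.
have mI C : measurable C -> measurable (E `&` D n @^-1` C).
  by move=> mC; apply: measurableI => //; rewrite -[_ @^-1` _]setTI; exact: measurable_funP.
have PI C : measurable C -> P (E `&` D n @^-1` C) = (P E * exponential_prob mu C)%E.
  move=> mC; rewrite (free_of1 fE (ltnSn n) mC).
  by congr (_ * _)%E; exact: lD.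
have PB F (mF : measurable F) B : measurable B ->
    free_of P D (fun k => (k < n)%N) F ->
    P (F `&` tau n @^-1` B) = (P F * renewal_mean mu n (EFin \o \1_B))%E.
  move=> mB fF; have mtB : measurable (tau n @^-1` B).
    by rewrite -[_ @^-1` _]setTI; exact: measurable_funP.
  rewrite -(IH _ mF) //; last first.
    by move=> x; rewrite lee_fin.
    apply/measurable_EFinP; exact: measurable_indic.
  rewrite -[RHS]/(\int[mrestr P mF]_w (\1_(tau n @^-1` B) w)%:E)%E.
  by rewrite integral_indic// setIT /mrestr setIC.
have -> : (\int[mrestr P mE]_w f (tau n.+1 w) =
    \int[mrestr P mE]_w f (tau n w + D n w)%R)%E.
  by apply: eq_integral => w _; congr f; rewrite /= addrC subrK.
rewrite -[RHS]/(P E * renewal_mean mu n (expo_step mu f))%E -(IH _ mE)//; last 2 first.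
- exact: measurable_expo_step.
- by move=> x; exact: expo_step_ge0.
pose Ex := expo_probability mu0.
rewrite (@ge0_integral_freeze _ _ _ T R (measurableTypeR R) R (mrestr P mE) (tau n) (D n)
  (measurable_funP (tau n)) (measurable_funP (D n)) Ex _ (fun z => f (z.1 + z.2)%R)).
- by [].
- move=> B C mB mC; rewrite /= /mrestr.
  rewrite [X in P X = _]setIC [in LHS]setIA setIAC PB//; last first.
    apply: (@free_of_sub _ _ _ _ _ _ _ [pred k | (k < n.+1)%N && (k != n)]).
      by move=> k kn; apply/andP; split; [exact: ltnW|rewrite ltn_eqF].
    exact: (free_ofI fE (ltnSn n) mC).
    exact: mI.
  by rewrite PI// setIC PB// muleAC.
- apply: measurableT_comp => //; exact: measurable_funD.
- by [].
Qed.

Lemma renewal_mean_tau n (f : R -> \bar R) :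
  measurable_fun setT f -> (forall x, 0 <= f x)%E ->
  (\int[P]_w f (tau n w) = renewal_mean mu n f)%E.
Proof.
move=> mf f0; have [_ iD _] := rtau.
rewrite -[RHS]mul1e -(probability_setT P) -(@renewal_law _ _ measurableT)//; last first.
  exact: free_of_setT.
by apply: eq_measure_integral => A mA _; rewrite /= /mrestr setIT.
Qed.

(** The event that the n-th gap lies in C is free of the earlier gaps, so that
    renewal_law gives the joint law of tau_n and that gap. *)
Lemma renewal_gap_indep n B C : measurable B -> measurable C ->
  P (tau n @^-1` B `&` D n @^-1` C) = (P (tau n @^-1` B) * exponential_prob mu C)%E.
Proof.
move=> mB mC; have [_ iD lD] := rtau.
have mDC : measurable (D n @^-1` C).
  by rewrite -[_ @^-1` _]setTI; exact: measurable_funP.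
have fT : free_of P D predT setT by exact: free_of_setT.
have fC : free_of P D (fun k => (k < n)%N) (D n @^-1` C).
  rewrite -[_ @^-1` _]setTI; apply: free_of_sub (free_ofI fT _ mC) => // k kn.
  by apply/andP; split => //; rewrite ltn_eqF.
have mb : measurable_fun setT (EFin \o (\1_B : R -> R)).
  apply/measurable_EFinP; exact: measurable_indic.
have b0 x : (0 <= (EFin \o (\1_B : R -> R)) x)%E by rewrite lee_fin.
have := renewal_law mDC fC mb b0.
rewrite -(renewal_mean_tau n mb b0).
rewrite -[in LHS]/(\int[mrestr P mDC]_w (\1_(tau n @^-1` B) w)%:E)%E.
rewrite (_ : (\int[P]_w (EFin \o _) _ = \int[P]_w (\1_(tau n @^-1` B) w)%:E)%E)//.
have mtB : measurable (tau n @^-1` B).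
  by rewrite -[_ @^-1` _]setTI; exact: measurable_funP.
rewrite !integral_indic// !setIT => H; apply: (etrans H); rewrite muleC; congr (_ * _)%E.
exact: lD.
Qed.

End renewal.

(** * Sums of geometric marks *)

Section negbin.
Context (R : realType) (a : R).
Local Notation b := (1 - a).

(** The geometric law on the positive integers. *)
Definition geo (v : nat) : R := if v is u.+1 then a * b ^+ u else 0.

(** The law of the sum of l independent variables of law geo, i.e. the negative
    binomial law counting trials. *)
Definition negbin (l m : nat) : R :=
  match l, m with
  | 0, _ => (m == 0)%N%:R
  | l'.+1, 0 => 0
  | l'.+1, m'.+1 => 'C(m', l')%:R * a ^+ l * b ^+ (m - l)
  end.

Lemma geo_ge0 v : 0 <= a -> a <= 1 -> 0 <= geo v.
Proof. by case: v => //= v a0 a1; rewrite mulr_ge0// exprn_ge0// subr_ge0. Qed.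

Lemma negbin_ge0 l m : 0 <= a -> a <= 1 -> 0 <= negbin l m.
Proof.
move=> a0 a1; case: l m => [|l] [|m] //=.
by rewrite !mulr_ge0 ?ler0n ?exprn_ge0// subr_ge0.
Qed.

Lemma hockey_stick l m : (\sum_(u < m) 'C(u, l) = 'C(m, l.+1))%N.
Proof. by elim: m => [|m IH]; rewrite ?big_ord0// big_ord_recr/= IH binS. Qed.

(** The convolution with one more geometric variable is the hockey-stick identity
    for binomial coefficients. *)
Lemma negbinS l m : negbin l.+1 m = \sum_(v < m.+1) geo v * negbin l (m - v).
Proof.
rewrite big_ord_recl/= mul0r add0r.
case: m => [|m]; first by rewrite big_ord0.
under eq_bigr do rewrite /bump/= subSS.
case: l => [|l].
  rewrite big_ord_recr/= subnn eqxx mulr1 big1 ?add0r ?bin0 ?mul1r ?subn1//.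
  by move=> i _; rewrite subn_eq0 leqNgt ltn_ord mulr0.
rewrite big_ord_recr/= subnn mulr0 addr0 -hockey_stick natr_sum !mulr_suml.
rewrite (reindex_inj rev_ord_inj)/=; apply: eq_bigr => i _.
rewrite subSS; have im := ltn_ord i.
rewrite (_ : (m - i = (m - i.+1).+1)%N); last by lia.
have [li|li] := leqP l (m - i.+1).
  rewrite (_ : (m - l.+1 = i + ((m - i.+1).+1 - l.+1))%N); last by lia.
  by rewrite add0n exprD [in LHS]exprS; ring.
by rewrite bin_small// !mul0r mulr0.
Qed.

End negbin.

Section marks.
Context (d : measure_display) (T : measurableType d) (R : realType)
  (P : probability T R) (a : R) (mark : nat -> {RV P >-> nat}).
Hypotheses (a0 : 0 < a) (a1 : a < 1).
Hypothesis mark_geo : forall k, geometric_law P a (mark k).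
Local Notation b := (1 - a).

Let measurable_mark_in k (B : set nat) : measurable (mark k @^-1` B).
Proof. by rewrite -[_ @^-1` _]setTI; exact: measurable_funP. Qed.

(** The values at the positive integers already exhaust the total mass: the
    probability of 0 is below b^n for every n. *)
Lemma mark_neq0 k : P [set w | mark k w = 0%N] = 0%E.
Proof.
apply/eqP; rewrite eq_le measure_ge0 andbT.
have b0 : 0 <= b by rewrite subr_ge0 ltW.
have b1 : `|b| < 1 by rewrite ger0_norm// ltrBlDr ltrDl.
pose x := fine (P [set w | mark k w = 0%N]).
have xE : P [set w | mark k w = 0%N] = x%:E.
  by rewrite fineK// fin_num_measure//; exact: (measurable_mark_in k [set 0%N]).
have le n : x <= b ^+ n.
  have := @measure_ord_bigcup _ _ _ P n.+1 (fun v => mark k @^-1` [set v]).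
  rewrite big_ord_recl => H.
  have : (P (mark k @^-1` [set 0%N]) + (1 - b ^+ n)%:E <= 1)%E.
    apply: le_trans (probability_le1 P (_ : measurable
      [set w | exists2 v, (v < n.+1)%N & (mark k @^-1` [set v]) w])); last first.
      rewrite (_ : [set w | _] = mark k @^-1` [set v | (v < n.+1)%N])//.
      by apply/seteqP; split => w /= => [[v vn ->]//|kn]; exists (mark k w).
    rewrite H//; last by move=> u v w /= -> ->.
    rewrite leeD2l//.
    rewrite (eq_bigr (fun i : 'I_n => (a * b ^+ i)%:E)); last first.
      by move=> i _; exact: mark_geo.
    rewrite sumEFin -big_distrr/= lee_fin.
    have := subrX1 b n; rewrite addrAC subrr add0r mulNr => /eqP.
    by rewrite -eqr_oppLR opprB => /eqP ->.
  by rewrite [P (_ @^-1` _)]xE -EFinD lee_fin => H'; lra.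
rewrite xE lee_fin; apply: (ler_cvg_to (@cvg_cst R x nat \oo _) (cvg_expr b1)).
by apply: nearW => n; exact: le.
Qed.

Lemma mark_law k v : P (mark k @^-1` [set v]) = (geo a v)%:E.
Proof. by case: v => [|v]; [exact: mark_neq0|exact: mark_geo]. Qed.

(** Split according to the value v of the last mark; the event E intersected with
    it is still free of the remaining marks. *)
Lemma sum_marks_law l n m E : measurable E ->
  free_of P mark [pred k | (n <= k < n + l)%N] E ->
  P (E `&` [set w | (\sum_(n <= k < n + l) mark k w)%N = m]) =
  (P E * (negbin a l m)%:E)%E.
Proof.
elim: l m E => [|l IH] m E mE fE.
  have [->|m0] := eqVneq m 0%N.
    rewrite mule1; congr (P _); apply/seteqP; split => w //=; first by case.
    by rewrite addn0 big_geq.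
  rewrite /= (negbTE m0) mule0 -[RHS](measure0 P); congr (P _); apply/seteqP; split => w //=.
  by rewrite addn0 big_geq// => -[_ /esym/eqP]; rewrite (negbTE m0).
have mS v := measurable_sum_eq n l v measurable_mark_in.
have knl : (n + l)%N \in [pred k | (n <= k < n + l.+1)%N].
  by rewrite inE leq_addr addnS ltnSn.
rewrite negbinS -sumEFin ge0_sume_distrr; last first.
  by move=> v _; rewrite lee_fin mulr_ge0 ?geo_ge0 ?negbin_ge0 ?(ltW a0) ?(ltW a1).
pose F v := E `&` mark (n + l)%N @^-1` [set v] `&`
    [set w | (\sum_(n <= k < n + l) mark k w)%N = (m - v)%N].
transitivity (P [set w | exists2 v, (v < m.+1)%N & F v w]).
  congr (P _); apply/seteqP; split => w /=.
    rewrite addnS big_nat_recr ?leq_addr//= => -[Ew Sm].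
    exists (mark (n + l)%N w); first by rewrite ltnS -Sm leq_addl.
    by split => //; rewrite -Sm addnK.
  move=> [v vm [[Ew Xv] S]]; split => //.
  by rewrite addnS big_nat_recr ?leq_addr//= S Xv subnK.
rewrite measure_ord_bigcup.
- apply: eq_bigr => v _; apply: (etrans (IH (m - v)%N _ _ _)).
  + exact: measurableI.
  + apply: free_of_sub (free_ofI fE knl _) => // k.
    rewrite !inE => /andP[nk kl]; apply/andP; split; last by rewrite ltn_eqF.
    by rewrite nk/= addnS ltnW.
  + by rewrite (free_of1 fE knl)// mark_law EFinM muleA.
- by move=> v; apply: measurableI => //; exact: measurableI.
- by move=> u v w /= [[_ <-] _] [[_ <-] _].
Qed.

End marks.

(** * Sample paths of the marked process *)

Lemma eseries_stationary (R : realType) (f : nat -> \bar R) N :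
  (forall k, (N <= k)%N -> f k = 0%E) ->
  (\sum_(0 <= k <oo) f k = \sum_(0 <= k < N) f k)%E.
Proof.
move=> f0; apply: lim_near_cst => //; near=> n.
have Nn : (N <= n)%N by near: n; exact: nbhs_infty_ge.
rewrite (big_cat_nat (leq0n N) Nn)//= [X in (_ + X)%E]big1_seq ?adde0// => k.
by rewrite mem_index_iota/= => /andP[Nk _]; exact: f0.
Unshelve. all: by end_near. Qed.

Lemma initial_segment (D : pred nat) : (forall k, D k.+1 -> D k) ->
  (exists n, forall k, D k = (k < n)%N) \/ (forall k, D k).
Proof.
move=> dD; have [[k Dk]|noD] := pselect (exists k, ~~ D k); last first.
  by right=> k; apply/negPn/negP => Dk; apply: noD; exists k.
left; pose n := ex_minn (ex_intro (fun k => ~~ D k) k Dk).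
exists n => j; rewrite /n; case: ex_minnP => m Dm min.
have [jm|mj] := ltnP j m.
  by apply/negPn/negP => Dj; have := min _ Dj; rewrite leqNgt jm.
apply/negbTE; apply: contra Dm; rewrite -(subnK mj).
by elim: (j - m)%N => // i IH /dD.
Qed.

(** D is the set of points up to some time u, an initial segment of the indices, and
    n the number of points up to an earlier time. If all indices were in D the
    series would diverge. *)
Lemma count_initial_segment (R : realType) (D : pred nat) n l :
  (forall k, D k.+1 -> D k) -> (forall k, (k < n)%N -> D k) ->
  (\sum_(0 <= k <oo) ((D k && ~~ (k < n)%N)%:R%:E : \bar R) = l%:R%:E)%E <->
  forall k, D k = (k < n + l)%N.
Proof.
move=> dD Dn.
have partial N m : (forall k, (k < N)%N -> D k = (k < n + m)%N) -> (n + m <= N)%N ->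
    (\sum_(0 <= k < N) ((D k && ~~ (k < n)%N)%:R%:E : \bar R) = m%:R%:E)%E.
  move=> DN nmN; rewrite (big_cat_nat (leq0n _) nmN)//= [X in (_ + X)%E]big1_seq ?adde0; last first.
    move=> k; rewrite mem_index_iota/= => /andP[nmk kN].
    by rewrite DN// ltnNge nmk.
  rewrite (big_cat_nat (leq0n n) (leq_addr m n))//= big1_seq ?add0e; last first.
    by move=> k; rewrite mem_index_iota => /= kn; rewrite kn andbF.
  rewrite (eq_big_nat _ _ (F2 := fun=> 1%E)); last first.
    move=> k /andP[nk km]; have Dk : D k by rewrite DN // (leq_trans km).
    by rewrite Dk (ltnNge k n) nk.
  by rewrite sumEFin big_const_nat iter_addr_0 addnC addnK.
split=> [S|DE]; last first.
  rewrite (@eseries_stationary _ _ (n + l)); first by apply: partial.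
  by move=> k; rewrite leqNgt -DE => /negbTE ->.
have [[m Dm]|DT] := initial_segment dD.
  have nm : (n <= m)%N.
    by rewrite leqNgt; apply/negP => mn; have := Dn _ mn; rewrite Dm ltnn.
  move: S; rewrite (@eseries_stationary _ _ m); last first.
    by move=> k; rewrite leqNgt -Dm => /negbTE ->.
  rewrite (partial m (m - n)%N); last 2 first.
  - by move=> k _; rewrite Dm subnKC.
  - by rewrite subnKC.
  by move=> [] /eqP; rewrite eqr_nat => /eqP <- k; rewrite subnKC.
have : ((\sum_(0 <= k < n + l.+1) ((D k && ~~ (k < n)%N)%:R%:E : \bar R)) <=
    \sum_(0 <= k <oo) ((D k && ~~ (k < n)%N)%:R%:E : \bar R))%E.
  by apply: nneseries_lim_ge => k _ _; rewrite lee_fin.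
rewrite S (partial _ l.+1)//; last by move=> k ->; rewrite DT.
by rewrite lee_fin ler_nat ltnn.
Qed.

Section sample_path.
Context (d : measure_display) (T : measurableType d) (R : realType)
  (p : nat -> T -> R) (mark : nat -> T -> nat) (w : T).
Hypothesis p_ndecr : forall k, p k w <= p k.+1 w.
Local Notation A s := (marked_process p mark s w).

(** No such n exists when the points accumulate at or before s. *)
Definition points_upto (s : R) (n : nat) : Prop :=
  forall k, (p k w <= s) = (k < n)%N.

Let p_mono i j : (i <= j)%N -> p i w <= p j w.
Proof.
move=> /subnK <-; elim: (j - i)%N => // k IH.
by rewrite addSn; exact: le_trans (p_ndecr _).
Qed.

Lemma points_upto_or_all s : (exists n, points_upto s n) \/ (forall k, p k w <= s).
Proof.
apply: (@initial_segment (fun k => p k w <= s)) => k.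
exact: le_trans.
Qed.

Lemma count_from0 s n : 0 < p 0%N w ->
  point_count p `]0, s] w = n%:R%:E <-> points_upto s n.
Proof.
move=> p0; rewrite /point_count.
rewrite (_ : (\sum_(0 <= k <oo) _)%E =
    (\sum_(0 <= k <oo) (((p k w <= s) && ~~ (k < 0)%N)%:R%:E))%E); last first.
  apply: eq_eseriesr => k _; rewrite indicE mem_setE in_itv/=.
  by rewrite (lt_le_trans p0 (p_mono _))//= andbT.
rewrite (@count_initial_segment _ (fun k => p k w <= s) 0 n)//.
by move=> k; exact: le_trans.
Qed.

Lemma count_from s u n l : s <= u -> points_upto s n ->
  point_count p `]s, u] w = l%:R%:E <-> points_upto u (n + l).
Proof.
move=> su sn; rewrite /point_count.
rewrite (_ : (\sum_(0 <= k <oo) _)%E =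
    (\sum_(0 <= k <oo) (((p k w <= u) && ~~ (k < n)%N)%:R%:E))%E); last first.
  by apply: eq_eseriesr => k _; rewrite indicE mem_setE in_itv/= -sn -ltNge andbC.
rewrite (@count_initial_segment _ (fun k => p k w <= u) n l)//.
  by move=> k; exact: le_trans.
by move=> k; rewrite -sn => /le_trans; apply.
Qed.

Let term_ge0 s k : (0 <= ((mark k w)%:R * \1_`]-oo, s] (p k w))%:E :> \bar R)%E.
Proof. by rewrite lee_fin mulr_ge0. Qed.

Let termE s k : \1_`]-oo, s] (p k w) = (p k w <= s)%R%:R :> R.
Proof. by rewrite indicE mem_setE in_itv. Qed.

Lemma marked_process_upto s n : points_upto s n ->
  A s = (\sum_(0 <= k < n) mark k w)%N%:R%:E.
Proof.
move=> sn; rewrite /marked_process (@eseries_stationary _ _ n); last first.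
  by move=> k; rewrite leqNgt -sn termE => /negbTE ->; rewrite mulr0.
rewrite natr_sum -sumEFin; apply: eq_big_nat => k /= kn.
by rewrite termE sn kn mulr1.
Qed.

Lemma marked_process_all s : (forall k, p k w <= s) -> (forall k, mark k w != 0%N) ->
  A s = +oo%E.
Proof.
move=> ps m0; apply/eqyP => M M0.
apply: le_trans (nneseries_lim_ge (Num.truncn M).+1 _); last by move=> k _ _; exact: term_ge0.
apply: (@le_trans _ _ (\sum_(0 <= k < (Num.truncn M).+1) 1%:E)%E).
  rewrite sumEFin big_const_nat iter_addr_0 subn0 lee_fin.
  by apply: ltW; exact: truncnS_gt.
apply: lee_sum => k _; rewrite lee_fin termE ps mulr1 ler1n lt0n; exact: m0.
Qed.

Lemma marked_process_le s u : s <= u -> (A s <= A u)%E.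
Proof.
move=> su; apply: lee_nneseries => k _; first by move=> _; exact: term_ge0.
rewrite lee_fin !termE.
rewrite ler_wpM2l// ler_nat; case: (leP (p k w) s) => // /le_trans -> //.
Qed.

(** Either all the points come at or before s and nothing happens any more, or
    there is a first point after s. This holds for every path, because the
    points are enumerated in nondecreasing order. *)
Lemma marked_process_right s : exists2 u, s < u &
  forall v, s <= v -> v < u -> A v = A s.
Proof.
suff [u su uP] : exists2 u, s < u &
    forall v, s <= v -> v < u -> forall k, (p k w <= v) = (p k w <= s).
  exists u => // v sv vu; apply: eq_eseriesr => k _.
  by rewrite !termE (uP v).
have [[n sn]|ps] := points_upto_or_all s; last first.
  exists (s + 1); first by rewrite ltrDl.
  by move=> v sv _ k; rewrite ps (le_trans (ps k)).
exists (p n w); first by rewrite ltNge sn ltnn.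
move=> v sv vn k; have [ks|] := boolP (p k w <= s); first exact: le_trans sv.
rewrite sn -leqNgt => nk; apply/negbTE; rewrite -ltNge.
exact: lt_le_trans (p_mono nk).
Qed.

End sample_path.

(** * Increments of the marked Poisson process *)

Lemma measurable_point_count (d : measure_display) (T : measurableType d)
  (R : realType) (p : nat -> T -> R) (B : set R) :
  (forall k, measurable_fun setT (p k)) -> measurable B ->
  measurable_fun setT (point_count p B).
Proof.
move=> mp mB; apply: ge0_emeasurable_sum.
  by move=> k w _ _; rewrite lee_fin.
move=> k _; apply/measurable_EFinP; exact: measurableT_comp (measurable_indic mB) (mp k).
Qed.

Lemma measurable_marked_process (d : measure_display) (T : measurableType d)
  (R : realType) (p : nat -> T -> R) (mark : nat -> T -> nat) (s : T -> R) :
  (forall k, measurable_fun setT (p k)) -> (forall k, measurable_fun setT (mark k)) ->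
  measurable_fun setT s ->
  measurable_fun setT (fun w => marked_process p mark (s w) w).
Proof.
move=> mp mm ms; apply: ge0_emeasurable_sum.
  by move=> k w _ _; rewrite lee_fin mulr_ge0.
move=> k _; apply/measurable_EFinP; apply: measurable_funM.
  exact: (@measurableT_comp _ _ _ _ _ _ (fun n : nat => n%:R : R)).
rewrite (_ : (fun w => _) = \1_[set w | p k w <= s w]); last first.
  by apply/funext => w; rewrite !indicE !mem_setE in_itv.
apply: measurable_indic.
rewrite -[X in measurable X]setTI.
have := measurable_fun_ler (mp k) ms measurableT (Y := [set true]).
by apply.
Qed.

Section compound_poisson.
Context (d : measure_display) (T : measurableType d) (R : realType)
  (P : probability T R) (lambda a : R) (p : nat -> {RV P >-> R})
  (mark : nat -> {RV P >-> nat}).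
Hypotheses (lambda0 : 0 < lambda) (a0 : 0 < a) (a1 : a < 1).
Hypothesis mpp : marked_poisson_process lambda a p mark.
Local Notation p_ := (fun k => p k : T -> R).
Local Notation mark_ := (fun k => mark k : T -> nat).
Local Notation A := (marked_process p_ mark_).

(** The compound Poisson law. The sum stops at n = j because the marks are
    positive. *)
Definition cp_pmf (s : R) (j : nat) : R :=
  \sum_(n < j.+1) pois lambda n s * negbin a n j.

Definition counts (s u : R) (n l : nat) : set T :=
  [set w | point_count p_ `]0, s] w = n%:R%:E] `&`
  [set w | point_count p_ `]s, u] w = l%:R%:E].

Lemma counts_generated s u n l :
  sigma_generated p_ (counts s u n l).
Proof.
pose Tp := g_sigma_algebraType (\bigcup_k preimage_set_system [set: T] (p_ k) measurable).
suff : measurable (counts s u n l : set Tp) by [].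
have mc B x : measurable B -> measurable ([set w | point_count p_ B w = x] : set Tp).
  move=> mB; rewrite -[X in measurable X]setTI.
  have mp := @measurable_point_count _ Tp R p_ B
    (fun k => @measurable_generated _ _ _ _ p_ k) mB.
  exact: mp measurableT _ (emeasurable_set1 x).
by apply: measurableI; apply: mc.
Qed.

Lemma measurable_counts s u n l : measurable (counts s u n l).
Proof.
have mc B x : measurable B -> measurable [set w | point_count p_ B w = x].
  move=> mB; rewrite -[X in measurable X]setTI.
  have mp := @measurable_point_count _ T R p_ B (fun k => measurable_funP (p k)) mB.
  exact: mp measurableT _ (emeasurable_set1 x).
by apply: measurableI; apply: mc.
Qed.

Lemma counts_law s e n l : 0 < s -> 0 < e ->
  P (counts s (s + e) n l) = (pois lambda n s * pois lambda l e)%:E.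
Proof.
move=> s0 e0; have [[p0 pn pN pI] _ _ _] := mpp.
(* The law of two consecutive counts, read off the sequence 0, s, s + e, s + e, ... *)
pose sq k := if k is k'.+1 then (if k' is 0%N then s else s + e) else 0.
have sq0 : 0 <= sq 0%N by [].
have sqn k : sq k <= sq k.+1.
  by case: k => [|[|k]] //=; rewrite ?(ltW s0)// lerDl ltW.
have := pI sq (fun k => if k is 0%N then n else l) sq0 sqn [:: 0; 1]%N isT.
rewrite !big_cons big_nil mule1 /=.
rewrite (pN _ _ _ _ s0)// (pN _ _ _ (ltW s0)) ?ltrDl//.
rewrite subr0 addrAC subrr add0r !pois_pmf// -EFinM => <-.
congr (P _); apply/seteqP; split => w /=.
  by move=> [H1 H2] k /=; rewrite !inE => /orP[/eqP->|/eqP->].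
by move=> H; split; [apply: (H 0%N)|apply: (H 1%N)]; rewrite /= !inE.
Qed.

(** The numbers of points depend on the point process only, which is independent of
    the marks. *)
Lemma free_counts s u n l : free_of P mark predT (counts s u n l).
Proof.
move=> B mB J uJ _; have [_ im _ ipm] := mpp.
rewrite setIC ipm.
- by rewrite muleC; congr (_ * _)%E; exact: im.
- pose Tm := g_sigma_algebraType (\bigcup_k preimage_set_system [set: T] (mark_ k) measurable).
  suff : measurable ((\bigcap_(k in [set` J]) (mark k @^-1` B k)) : set Tm) by [].
  apply: bigcap_measurableType => //.
  move=> k _; rewrite -[X in measurable X]setTI.
  exact: (@measurable_generated _ _ _ _ mark_ k measurableT _ (mB k)).
- exact: counts_generated.
Qed.

Let measurable_sum n l v : measurable [set w | (\sum_(n <= k < n + l) mark k w)%N = v].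
Proof.
apply: measurable_sum_eq => k B; rewrite -[X in measurable X]setTI.
exact: measurable_funP.
Qed.

Definition mark_paths (s u : R) (j m n l : nat) : set T :=
  counts s u n l `&` [set w | (\sum_(0 <= k < 0 + n) mark k w)%N = j] `&`
  [set w | (\sum_(n <= k < n + l) mark k w)%N = m].

Lemma measurable_mark_paths s u j m n l : measurable (mark_paths s u j m n l).
Proof. by apply: measurableI => //; apply: measurableI => //; exact: measurable_counts. Qed.

(** sum_marks_law is applied twice, to the later block of marks and then to the
    earlier one; the earlier block stays free of the later marks. *)
Lemma mark_paths_law s e j m n l : 0 < s -> 0 < e ->
  P (mark_paths s (s + e) j m n l) =
  ((pois lambda n s * negbin a n j) * (pois lambda l e * negbin a l m))%:E.
Proof.
move=> s0 e0; have [_ _ geo _] := mpp.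
have fN := @free_counts s (s + e) n l.
have mN := @measurable_counts s (s + e) n l.
have fN1 : P (counts s (s + e) n l `&` [set w | (\sum_(0 <= k < 0 + n) mark k w)%N = j]) =
    (P (counts s (s + e) n l) * (negbin a n j)%:E)%E.
  by apply: sum_marks_law => //; apply: free_of_sub fN.
rewrite /mark_paths (sum_marks_law a0 a1 geo)//.
- by rewrite fN1 counts_law// -!EFinM; congr (_%:E); ring.
- exact: measurableI.
move=> B mB J uJ JK; rewrite setIAC (sum_marks_law a0 a1 geo).
- by rewrite fN// fN1 muleAC.
- apply: measurableI => //; apply: bigcap_measurableType => // k _.
  by rewrite -[X in measurable X]setTI; exact: measurable_funP.
- apply: free_of_sub (free_of_bigcap fN mB uJ _) => //.
  move=> k; rewrite !inE => kn; apply/negP => /JK; rewrite !inE.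
  by case/andP => nk _; move: kn; rewrite add0n ltnNge nk.
Qed.

End compound_poisson.

Section compound_poisson_law.
Context (d : measure_display) (T : measurableType d) (R : realType)
  (P : probability T R) (lambda a : R) (p : nat -> {RV P >-> R})
  (mark : nat -> {RV P >-> nat}).
Hypotheses (lambda0 : 0 < lambda) (a0 : 0 < a) (a1 : a < 1).
Hypothesis mpp : marked_poisson_process lambda a p mark.
Local Notation p_ := (fun k => p k : T -> R).
Local Notation mark_ := (fun k => mark k : T -> nat).
Local Notation A := (marked_process p_ mark_).

Let p_ndecr w k : p_ k w <= p_ k.+1 w.
Proof. by have [[_ pn _ _] _ _ _] := mpp. Qed.

Let p_gt0 w k : 0 < p_ k w.
Proof. by have [[p0 _ _ _] _ _ _] := mpp. Qed.

Definition positive_marks : set T := \bigcap_k [set w | mark k w <> 0%N].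

Let measurable_mark_neq0 k : measurable [set w | mark k w <> 0%N].
Proof.
rewrite -[X in measurable X]setTI.
exact: (@measurable_funP _ _ _ _ _ (mark k) measurableT (~` [set 0%N])).
Qed.

Lemma measurable_positive_marks : measurable positive_marks.
Proof. by apply: bigcap_measurableType => k _; exact: measurable_mark_neq0. Qed.

Lemma positive_marks_as : P (~` positive_marks) = 0%E.
Proof.
apply: bigcap_null => // k; have [_ _ geo _] := mpp.
rewrite -[RHS](mark_neq0 a0 a1 geo k); congr (P _); apply/seteqP; split => w /=.
  by move=> /contrapT.
by move=> ->; apply.
Qed.

Lemma marked_process_finite w s : positive_marks w -> (A s w < +oo)%E ->
  exists n, points_upto p_ w s n.
Proof.
move=> Gw As; have [//|ps] := @points_upto_or_all _ T R p_ w (p_ndecr w) s.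
move: As; rewrite (@marked_process_all _ T R p_ mark_ w s)//.
by move=> k; apply/eqP; exact: Gw.
Qed.

Lemma points_upto_le w s u n m : s <= u -> points_upto p_ w s n ->
  points_upto p_ w u m -> (n <= m)%N.
Proof.
move=> su sn um; rewrite leqNgt; apply/negP => mn.
by have := um m; rewrite ltnn (le_trans _ su)// sn.
Qed.

Lemma leq_sum_marks w n l : positive_marks w -> (l <= \sum_(n <= k < n + l) mark k w)%N.
Proof.
move=> Gw; rewrite -[X in (X <= _)%N](addKn n) -[X in (X <= _)%N]muln1 -sum_nat_const_nat.
by apply: leq_sum => k _; rewrite lt0n; apply/eqP; exact: Gw.
Qed.

Lemma measurable_process s : measurable_fun setT (A s).
Proof.
apply: (@measurable_marked_process _ _ _ p_ mark_ (fun=> s)) => //.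
Qed.

(** Where all marks are positive, A(s) = j bounds the number of points by j, so the
    event is a finite disjoint union of the events mark_paths and the double sum
    factors. *)
Lemma increments_law s e j m : 0 < s -> 0 < e ->
  P [set w | A s w = j%:R%:E /\ A (s + e) w = (j + m)%N%:R%:E] =
  (cp_pmf lambda a s j * cp_pmf lambda a e m)%:E.
Proof.
move=> s0 e0; set X := [set w | _].
have su : s <= s + e by rewrite lerDl ltW.
have mX : measurable X.
  apply: measurableI.
    rewrite -[X in measurable X]setTI; exact: measurable_process (emeasurable_set1 _).
  rewrite -[X in measurable X]setTI; exact: measurable_process (emeasurable_set1 _).
pose Y n := [set w | exists2 l, (l < m.+1)%N & mark_paths p mark s (s + e) j m n l w].
have mark_paths_inj n n' l l' w : mark_paths p mark s (s + e) j m n l w ->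
    mark_paths p mark s (s + e) j m n' l' w -> n = n' /\ l = l'.
  move=> [[[/= c1 c2] _] _] [[[/= c1' c2'] _] _].
  have nE : n = n'.
    by apply/eqP; rewrite -(eqr_nat R); move: c1; rewrite c1' => -[->].
  by split=> //; apply/eqP; rewrite -(eqr_nat R); move: c2; rewrite c2' => -[->].
have mY n : measurable (Y n).
  rewrite (_ : Y n = \bigcup_(l in [set l | (l < m.+1)%N]) mark_paths p mark s (s + e) j m n l).
    by apply: bigcup_measurable => l _; exact: measurable_mark_paths.
  by apply/seteqP; split => w [l ? ?]; exists l.
have mZ : measurable [set w | exists2 n, (n < j.+1)%N & Y n w].
  rewrite (_ : [set w | _] = \bigcup_(n in [set n | (n < j.+1)%N]) Y n).
    by apply: bigcup_measurable => n _; exact: mY.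
  by apply/seteqP; split => w [n ? ?]; exists n.
have mG := measurable_positive_marks.
rewrite -(measureI_null mG mX positive_marks_as).
transitivity (P [set w | exists2 n, (n < j.+1)%N & Y n w]).
  rewrite -(measureI_null mG mZ positive_marks_as).
  congr (P _); apply/seteqP; split => w /= [].
    move=> [As Au] Gw; split=> //.
    have [n sn] : exists n, points_upto p_ w s n.
      by apply: marked_process_finite => //; rewrite As ltry.
    have [n' un] : exists n, points_upto p_ w (s + e) n.
      by apply: marked_process_finite => //; rewrite Au ltry.
    have nn' := points_upto_le su sn un.
    move: As; rewrite (marked_process_upto _ sn) => -[] /eqP; rewrite eqr_nat => /eqP Sj.
    move: Au; rewrite (marked_process_upto _ un) => -[] /eqP; rewrite eqr_nat => /eqP.
    rewrite (big_cat_nat (leq0n n) nn')/= Sj => /addnI Sm.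
    exists n; first by rewrite ltnS -Sj; have := leq_sum_marks 0 n Gw; rewrite add0n.
    exists (n' - n)%N.
      by rewrite ltnS -Sm; have := leq_sum_marks n (n' - n) Gw; rewrite subnKC.
    split; last by rewrite /= subnKC.
    split; last by rewrite /= add0n.
    split => /=; first by apply/(@count_from0 _ _ _ p_).
    by apply/(@count_from _ _ _ p_) => //; rewrite subnKC.
  move=> [n nj [l lm [[[/= c1 c2] Sj] Sm]]] Gw; split => //.
  have sn : points_upto p_ w s n by apply/(@count_from0 _ _ _ p_).
  have un : points_upto p_ w (s + e) (n + l).
    by apply/(@count_from _ _ _ p_ w (p_ndecr w) s _ n l su sn).
  split; [apply: (etrans (marked_process_upto mark_ sn))|
          apply: (etrans (marked_process_upto mark_ un))].
    by rewrite -Sj add0n.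
  by rewrite (big_cat_nat (leq0n n) (leq_addr l n))/= Sm -Sj add0n.
rewrite measure_ord_bigcup//; last first.
  by move=> n n' w [l _ H] [l' _ H']; have [] := mark_paths_inj _ _ _ _ _ H H'.
transitivity (\sum_(n < j.+1) \sum_(l < m.+1)
   ((pois lambda n s * negbin a n j) * (pois lambda l e * negbin a l m))%:E)%E.
  apply: eq_bigr => n _; rewrite measure_ord_bigcup; last 2 first.
  - by move=> l; exact: measurable_mark_paths.
  - by move=> l l' w H H'; have [] := mark_paths_inj _ _ _ _ _ H H'.
  apply: eq_bigr => l _; exact: mark_paths_law.
under eq_bigr do rewrite sumEFin.
rewrite sumEFin; congr (_%:E); rewrite /cp_pmf mulr_suml.
by apply: eq_bigr => n _; rewrite mulr_sumr.
Qed.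

End compound_poisson_law.

(** * Joint measurability in time and chance *)

Section joint_measurability.
Context (d : measure_display) (T : measurableType d) (R : realType)
  (p : nat -> T -> R) (mark : nat -> T -> nat) (F : R -> set (set T)).
Local Notation A := (marked_process p mark).
Hypotheses (p_ndecr : forall w k, p k w <= p k.+1 w) (adF : adapted F A).
Local Notation TF := (g_sigma_algebraType (\bigcup_(s in [set s | 0 <= s]) F s)).

(** Since paths are constant to the right of s and nondecreasing, A(s) lies in the
    lower set D if and only if A(q) does for some rational q > s. The set is thus
    a countable union of rectangles. The absolute value keeps the times
    nonnegative, where the filtration is defined. *)
Lemma measurable_graph_downset (D : set (\bar R)) : measurable D ->
  (forall x y, (x <= y)%E -> D y -> D x) ->
  measurable [set z : R * TF | 0 <= z.1 /\ D (A z.1 z.2)].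
Proof.
move=> mD dD.
rewrite (_ : [set z | _] = \bigcup_(q : rat)
    (`[0, `|ratr q|[%classic `*` [set w : TF | D (A `|ratr q| w)])).
  apply: bigcupT_measurable_rat => q; apply: measurableX => //.
  by apply: sub_sigma_algebra; exists `|ratr q| => /=; [|exact: adF].
apply/seteqP; split => -[s w] /=.
  move=> [s0 DA]; have [u su Au] := @marked_process_right _ T R p mark w (p_ndecr w) s.
  have [q] := rat_in_itvoo su; rewrite in_itv/= => /andP[sq qu].
  exists q => //=; rewrite in_itv/= s0/= ger0_norm ?(le_trans s0 (ltW sq))//.
  by rewrite (Au _ (ltW sq) qu).
move=> [q _ /= []]; rewrite in_itv/= => /andP[s0 sq] DA; split => //.
by apply: dD DA; apply: marked_process_le; exact: ltW.
Qed.

Lemma measurable_graph (x : \bar R) :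
  measurable [set z : R * TF | 0 <= z.1 /\ A z.1 z.2 = x].
Proof.
rewrite (_ : [set z | _] =
    [set z : R * TF | 0 <= z.1 /\ `]-oo, x]%classic (A z.1 z.2)] `\`
    [set z : R * TF | 0 <= z.1 /\ `]-oo, x[%classic (A z.1 z.2)]).
  apply: measurableD; apply: measurable_graph_downset; try exact: emeasurable_itv.
    by move=> y z /= yz; rewrite !in_itv/=; exact: le_trans.
  by move=> y z /= yz; rewrite !in_itv/=; exact: le_lt_trans.
apply/seteqP; split => z /=; rewrite !in_itv/=.
  by move=> [z0 ->]; rewrite lexx ltxx; split => // -[].
move=> [[z0 zx] zx']; split => //; apply/eqP; rewrite eq_le zx/= leNgt.
by apply/negP => H; apply: zx'.
Qed.

End joint_measurability.

(** * Occupation density and law over one observation gap *)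

Section pois_mixture.
Context (R : realType) (l : R).
Hypothesis l0 : 0 < l.
Local Notation leb := (@lebesgue_measure R).

Lemma integral_pois_mixture (c : nat -> R) n (t : R) : 0 <= t ->
  (forall k, 0 <= c k) ->
  (\int[leb]_(s in `[t, +oo[) (\sum_(k < n) pois l k s * c k)%:E =
   (l^-1 * \sum_(k < n) c k * \sum_(i < k.+1) pois l i t)%:E)%E.
Proof.
move=> t0 c0; under eq_integral do rewrite -sumEFin.
have p0 k s : [set` `[t, +oo[%R] s -> 0 <= pois l k s.
  by rewrite /= in_itv/= andbT => ts; rewrite pois_ge0// (le_trans t0).
rewrite ge0_integral_sum//; last 2 first.
- move=> k; apply/measurable_EFinP/measurable_funTS.
  by apply: measurable_funM => //; exact: measurable_pois.
- by move=> k s ts; rewrite lee_fin mulr_ge0 ?c0 ?p0.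
rewrite mulr_sumr -sumEFin; apply: eq_bigr => k _.
under eq_integral do rewrite EFinM muleC.
rewrite ge0_integralZl//.
- by rewrite integral_pois// -EFinM; congr (_%:E); ring.
- by apply/measurable_EFinP/measurable_funTS; exact: measurable_pois.
- by move=> s ts; rewrite lee_fin p0.
- by rewrite lee_fin c0.
Qed.

End pois_mixture.

Section cp_pmf.
Context (R : realType) (lambda mu a : R).
Hypotheses (lambda0 : 0 < lambda) (mu0 : 0 < mu) (a0 : 0 < a) (a1 : a < 1).
Local Notation leb := (@lebesgue_measure R).

Lemma measurable_cp_pmf j : measurable_fun setT (cp_pmf lambda a ^~ j).
Proof.
apply: measurable_sum => k; apply: measurable_funM => //; exact: measurable_pois.
Qed.

Lemma cp_pmf_ge0 s j : 0 <= s -> 0 <= cp_pmf lambda a s j.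
Proof.
move=> s0; apply: sumr_ge0 => k _.
by rewrite mulr_ge0 ?pois_ge0 ?negbin_ge0 ?(ltW a0) ?(ltW a1).
Qed.

Lemma cp_pmf_after_ge0 t j x : 0 <= t ->
  0 <= ((cp_pmf lambda a ^~ j) \_ `]t, +oo[) x.
Proof.
move=> t0; rewrite patchE mem_setE in_itv/= andbT; case: ifPn => // tx.
by rewrite cp_pmf_ge0// (le_trans t0)// ltW.
Qed.

Lemma measurable_cp_pmf_after t j :
  measurable_fun setT ((cp_pmf lambda a ^~ j) \_ `]t, +oo[).
Proof.
apply/measurable_restrict => //; rewrite setTI; apply: measurable_funTS.
exact: measurable_cp_pmf.
Qed.

(** The expected number of observation times after t at which the process is in
    state j, see occupationE; the index 0 is not counted. *)
Definition occupation (t : R) (j : nat) : R :=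
  mu / lambda * \sum_(k < j.+1) negbin a k j * \sum_(i < k.+1) pois lambda i t.

(** The law of the increment of A over one exponential gap, see gap_pmfE. *)
Definition gap_pmf (m : nat) : R :=
  mu / (lambda + mu) * \sum_(k < m.+1) negbin a k m * (lambda / (lambda + mu)) ^+ k.

Lemma occupationE t j : 0 <= t ->
  (mu%:E * \int[leb]_(s in `[0%R, +oo[) (((cp_pmf lambda a ^~ j) \_ `]t, +oo[) s)%:E
   = (occupation t j)%:E)%E.
Proof.
move=> t0.
rewrite (_ : (\int[leb]_(s in _) _)%E =
   (\int[leb]_(s in `]t, +oo[) (cp_pmf lambda a s j)%:E)%E); last first.
  rewrite [LHS]integral_mkcond [RHS]integral_mkcond; apply: eq_integral => s _.
  rewrite !patchE !mem_setE !in_itv/= !andbT.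
  by have [ts|//] := ltP t s; rewrite ?if_same// (le_trans t0 (ltW ts)).
rewrite integral_itv_obnd_cbnd; last first.
  by apply/measurable_EFinP/measurable_funTS; exact: measurable_cp_pmf.
rewrite [X in (_ * X)%E](@integral_pois_mixture _ _ lambda0
  (fun k => negbin a k j) j.+1 t t0); last first.
  by move=> k; rewrite negbin_ge0 ?(ltW a0) ?(ltW a1).
by rewrite -EFinM mulrA.
Qed.

(** The product of a Poisson weight with rate lambda and of the exponential density
    of rate mu is, up to a constant, a Poisson weight with rate lambda + mu. *)
Lemma gap_pmfE m :
  (\int[expo_probability mu0]_e (((cp_pmf lambda a ^~ m) \_ `]0, +oo[) e)%:E
   = (gap_pmf m)%:E)%E.
Proof.
have lm0 : 0 < lambda + mu by rewrite addr_gt0.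
have h0 e : 0 <= ((cp_pmf lambda a ^~ m) \_ `]0, +oo[) e by exact: cp_pmf_after_ge0.
have mh := measurable_cp_pmf_after 0 m.
have pdf0 x : 0 <= exponential_pdf mu x by apply: exponential_pdf_ge0; exact: ltW.
have pdfE B : measurable B -> expo_probability mu0 B =
  (\int[leb]_(x in B) (exponential_pdf mu x)%:E)%E by [].
rewrite (@ge0_integral_density _ (measurableTypeR R) R leb (expo_probability mu0)
  (exponential_pdf mu) (@measurable_exponential_pdf R mu) pdf0 pdfE); last 2 first.
- exact/measurable_EFinP.
- by move=> x; rewrite lee_fin.
rewrite (_ : (\int[leb]_x _)%E = (\int[leb]_(x in `]0%R, +oo[)
  (\sum_(k < m.+1) pois (lambda + mu) k x *
     (mu * (lambda / (lambda + mu)) ^+ k * negbin a k m))%:E)%E); last first.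
  rewrite [RHS]integral_mkcond; apply: eq_integral => e _.
  rewrite !patchE !mem_setE !in_itv/= !andbT; case: ifPn => e0; last by rewrite mul0e.
  rewrite exponential_pdfE ?ltW// -EFinM; congr (_%:E).
  rewrite /cp_pmf mulr_suml; apply: eq_bigr => k _.
  have -> : pois (lambda + mu) k e = (lambda + mu) ^+ k * e ^+ k / k`!%:R *
      (expR (- (lambda * e)) * expR (- mu * e)).
    by rewrite /pois exprMn -expRD; congr (_ * expR _); ring.
  rewrite /pois !exprMn exprVn.
  have := expf_neq0 k (lt0r_neq0 lm0).
  have : k`!%:R != 0 :> R by rewrite pnatr_eq0 -lt0n fact_gt0.
  by move=> H1 H2; field; rewrite H1 H2.
rewrite integral_itv_obnd_cbnd; last first.
  apply/measurable_EFinP/measurable_funTS; apply: measurable_sum => k.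
  by apply: measurable_funM => //; exact: measurable_pois.
rewrite (@integral_pois_mixture _ _ lm0
  (fun k => mu * (lambda / (lambda + mu)) ^+ k * negbin a k m))//; last first.
  by move=> k; rewrite !mulr_ge0 ?exprn_ge0 ?divr_ge0 ?negbin_ge0 ?(ltW a0) ?(ltW a1)
    ?(ltW mu0) ?(ltW lambda0) ?(ltW lm0).
congr (_%:E); rewrite /gap_pmf [mu / _]mulrC -mulrA; congr (_ * _).
rewrite mulr_sumr; apply: eq_bigr => k _.
rewrite big_ord_recl big1 ?addr0; last by move=> i _; rewrite /pois mulr0 expr0n/= !mul0r.
by rewrite /pois mulr0 oppr0 expR0 expr0 fact0 divr1 !mulr1; ring.
Qed.

Lemma gap_pmf_ge0 m : 0 <= gap_pmf m.
Proof.
rewrite -lee_fin -gap_pmfE; apply: integral_ge0 => x _.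
by rewrite lee_fin; exact: cp_pmf_after_ge0.
Qed.

End cp_pmf.

(** * Two consecutive observations *)

Section observation.
Context (d : measure_display) (T : measurableType d) (R : realType)
  (P : probability T R) (lambda mu a : R) (p : nat -> {RV P >-> R})
  (mark : nat -> {RV P >-> nat}) (F : R -> set (set T)) (tau : nat -> {RV P >-> R}).
Local Notation p_ := (fun k => p k : T -> R).
Local Notation mark_ := (fun k => mark k : T -> nat).
Local Notation A := (marked_process p_ mark_).
Local Notation TF := (g_sigma_algebraType (\bigcup_(s in [set s | 0 <= s]) F s)).
Hypotheses (lambda0 : 0 < lambda) (mu0 : 0 < mu) (a0 : 0 < a) (a1 : a < 1).
Hypotheses (mpp : marked_poisson_process lambda a p mark) (filF : filtration F)
  (adF : adapted F A) (rtau : exponential_renewal mu tau)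
  (indep : independent_systems P (sigma_generated (fun n => tau n : T -> R))
             <<s \bigcup_(s in [set s | 0 <= s]) F s >>).

Let D (n : nat) : {mfun T >-> R} := [the {mfun T >-> R} of tau n.+1 \- tau n].

Let p_ndecr w k : p_ k w <= p_ k.+1 w.
Proof. by have [[_ pn _ _] _ _ _] := mpp. Qed.

Let measurable_toTF : measurable_fun setT (id : T -> TF).
Proof.
have [_ FT _] := filF.
move=> _ B mB; rewrite setTI.
have : <<s \bigcup_(s in [set s | 0 <= s]) F s >> `<=` @measurable _ T.
  apply: smallest_sub; first exact: sigma_algebra_measurable.
  by move=> C [s s0 /(FT _ s0)].
by apply.
Qed.

Let toTF : {mfun T >-> TF} :=
  HB.pack (id : T -> TF) (isMeasurableFun.Build _ _ _ _ _ measurable_toTF).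

Definition two_step (t : R) (j r : nat) : set ((R * R) * T) :=
  [set z | [/\ t < z.1.1, 0 < z.1.2, A z.1.1 z.2 = j%:R%:E &
             A (z.1.1 + z.1.2) z.2 = r%:R%:E]].

Lemma measurable_two_step t j r : 0 <= t ->
  measurable (two_step t j r : set ((R * R) * TF)).
Proof.
move=> t0.
have mg x (f : (R * R) * TF -> R) : measurable_fun setT f ->
    measurable [set z | 0 <= f z /\ A (f z) z.2 = x%:R%:E].
  move=> mf; have mfz : measurable_fun setT (fun z : (R * R) * TF => (f z, z.2)).
    exact: measurable_fun_pair.
  rewrite -[X in measurable X]setTI.
  exact: (mfz measurableT _ (@measurable_graph _ T R p_ mark_ F p_ndecr adF x%:R%:E)).
have m1 : measurable_fun setT (fun z : (R * R) * TF => z.1.1).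
  exact: (measurableT_comp measurable_fst).
have m2 : measurable_fun setT (fun z : (R * R) * TF => z.1.2).
  exact: (measurableT_comp measurable_snd).
have mt c (f : (R * R) * TF -> R) : measurable_fun setT f -> measurable [set z | c < f z].
  move=> mf; rewrite -[X in measurable X]setTI.
  rewrite (_ : [set z | _] = f @^-1` `]c, +oo[%classic); first exact: mf.
  by apply/seteqP; split => z /=; rewrite in_itv/= andbT.
rewrite (_ : two_step t j r = [set z : (R * R) * TF | t < z.1.1] `&` [set z | 0 < z.1.2] `&`
   ([set z | 0 <= z.1.1 /\ A z.1.1 z.2 = j%:R%:E] `&`
    [set z | 0 <= z.1.1 + z.1.2 /\ A (z.1.1 + z.1.2) z.2 = r%:R%:E])).
  apply: measurableI; apply: measurableI; [exact: mt|exact: mt|exact: mg|].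
  by apply: mg; exact: measurable_funD.
apply/seteqP; split => z /=; last by move=> [[? ?] [[? ?] [? ?]]]; split.
move=> [tz z0 Aj Ar]; split => //; split; split => //.
  by rewrite (le_trans t0)// ltW.
by rewrite addr_ge0// ?(ltW z0)// (le_trans t0)// ltW.
Qed.

Lemma two_step_section t j r x : 0 <= t -> (j <= r)%N ->
  (\int[distribution P toTF]_y (\1_(two_step t j r) (x, y))%:E =
   (((cp_pmf lambda a ^~ j) \_ `]t, +oo[) x.1 *
    ((cp_pmf lambda a ^~ (r - j)%N) \_ `]0, +oo[) x.2)%:E)%E.
Proof.
move=> t0 jr; have mC := @measurable_two_step t j r t0.
rewrite (_ : (fun y => _) =
  (EFin \o \1_(xsection (two_step t j r : set ((R * R) * TF)) x))); last first.
  by apply/funext => y /=; rewrite !indicE /xsection mem_setE.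
rewrite integral_indic//; last exact: measurable_xsection.
rewrite setIT !patchE !mem_setE !in_itv/= !andbT.
have secE : distribution P toTF (xsection (two_step t j r : set ((R * R) * TF)) x) =
    P [set w | two_step t j r (x, w)].
  by congr (P _); apply/seteqP; split => w; rewrite /= /xsection /= inE.
rewrite secE.
have [tx|xt] := ltP t x.1; last first.
  rewrite mul0r (_ : [set w | _] = set0) ?measure0//.
  by apply/seteqP; split => // w [/=]; rewrite ltNge xt.
have [x0|x0] := ltP 0 x.2; last first.
  rewrite mulr0 (_ : [set w | _] = set0) ?measure0//.
  by apply/seteqP; split => // w [/= _]; rewrite ltNge x0.
rewrite -(increments_law lambda0 a0 a1 mpp)//; last exact: le_lt_trans tx.
congr (P _); apply/seteqP; split => w /=; rewrite subnKC//.
  by move=> [].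
by move=> [].
Qed.

(** Freeze first the observation times and then tau_n. The sets involved are
    measurable for the filtration, which is independent of the observation times. *)
Lemma two_step_law n t j r : 0 <= t -> (j <= r)%N ->
  P [set w | two_step t j r ((tau n w, D n w), w)] =
  (renewal_mean mu n (EFin \o ((cp_pmf lambda a ^~ j) \_ `]t, +oo[)) *
   (gap_pmf lambda mu a (r - j))%:E)%E.
Proof.
move=> t0 jr; have mC := @measurable_two_step t j r t0.
pose g := (cp_pmf lambda a ^~ j) \_ `]t, +oo[.
pose h := (cp_pmf lambda a ^~ (r - j)%N) \_ `]0, +oo[.
have m1 : measurable_fun setT (fun w => (tau n w, D n w)).
  exact: measurable_fun_pair.
pose Ttau := g_sigma_algebraType
  (\bigcup_n preimage_set_system [set: T] (tau n : T -> R) measurable).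
have mtau k : measurable_fun (setT : set Ttau) (tau k : T -> R).
  exact: (@measurable_generated _ _ _ _ (fun n => tau n : T -> R) k).
have m1' : measurable_fun (setT : set Ttau) (fun w => (tau n w, D n w)).
  by apply: measurable_fun_pair => //; exact: measurable_funB.
have ind1 (B : set (R * R)) (C : set TF) : measurable B -> measurable C ->
    P ((fun w => (tau n w, D n w)) @^-1` B `&` toTF @^-1` C) =
    (P ((fun w => (tau n w, D n w)) @^-1` B) * distribution P toTF C)%E.
  move=> mB mC'; apply: indep => //.
  have : measurable (((fun w => (tau n w, D n w)) @^-1` B) : set Ttau).
    by rewrite -[X in measurable X]setTI; exact: m1'.
  by [].
have g0 x : 0 <= g x by exact: cp_pmf_after_ge0.
have h0 x : 0 <= h x by exact: cp_pmf_after_ge0.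
have mpatch m c := measurable_cp_pmf_after lambda a c m.
transitivity (\int[P]_w (\1_(two_step t j r) ((tau n w, D n w), toTF w))%:E)%E.
  rewrite (_ : (fun w => _) = EFin \o \1_[set w | two_step t j r ((tau n w, D n w), w)]); last first.
    by apply/funext => w /=; rewrite !indicE; congr (_%:R%:E).
  rewrite integral_indic ?setIT//.
  rewrite -[X in measurable X]setTI.
  have mm : measurable_fun setT (fun w => ((tau n w, D n w), toTF w)).
    exact: measurable_fun_pair.
  exact: mm.
rewrite (@ge0_integral_freeze _ _ _ T _ TF R P (fun w => (tau n w, D n w)) toTF
  m1 (measurable_funP toTF) (distribution P toTF) ind1
  (fun z : (R * R) * TF => (\1_(two_step t j r) z)%:E)); last 2 first.
- by apply/measurable_EFinP; exact: measurable_indic.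
- by move=> z; rewrite lee_fin.
under eq_integral do rewrite two_step_section//.
have ind2 (B : set R) (C : set (measurableTypeR R)) : measurable B -> measurable C ->
    P (tau n @^-1` B `&` D n @^-1` C) = (P (tau n @^-1` B) * expo_probability mu0 C)%E.
  by move=> mB mC'; exact: renewal_gap_indep.
rewrite (@ge0_integral_freeze _ _ _ T R (measurableTypeR R) R P (tau n) (D n)
  (measurable_funP (tau n)) (measurable_funP (D n)) (expo_probability mu0) ind2
  (fun z => (g z.1 * h z.2)%:E)); last 2 first.
- apply/measurable_EFinP; apply: measurable_funM.
    exact: (measurableT_comp (mpatch _ _) measurable_fst).
  exact: (measurableT_comp (mpatch _ _) measurable_snd).
- by move=> z; rewrite lee_fin mulr_ge0.
have hE s : (\int[expo_probability mu0]_y (g s * h y)%:E =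
    (g s)%:E * (gap_pmf lambda mu a (r - j))%:E)%E.
  rewrite -(gap_pmfE lambda0 mu0 a0 a1) -ge0_integralZl//.
  - by apply/measurable_EFinP; exact: mpatch.
  - by move=> x _; rewrite lee_fin; exact: h0.
  - by rewrite lee_fin.
under eq_integral do rewrite hE.
rewrite ge0_integralZr//; last 3 first.
- apply/measurable_EFinP.
  exact: (measurableT_comp (mpatch j t) (measurable_funP (tau n))).
- by move=> w _; rewrite lee_fin.
- by rewrite lee_fin gap_pmf_ge0.
congr (_ * _)%E.
apply: (@renewal_mean_tau _ _ _ P mu tau mu0 rtau n (EFin \o g)).
- by apply/measurable_EFinP; exact: mpatch.
- by move=> x; rewrite lee_fin.
Qed.

End observation.

(** * Decomposition of the exit event *)

(** An infimum of a set of integers that is finite is attained. *)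
Lemma exit_indexP (d : measure_display) (T : measurableType d) (R : realType)
  (X : nat -> T -> \bar R) M n w :
  exit_index X M w = n%:R%:E <->
  (M%:R%:E <= X n w)%E /\ forall k, (k < n)%N -> (X k w < M%:R%:E)%E.
Proof.
have lb k : (M%:R%:E <= X k w)%E -> (exit_index X M w <= k%:R%:E)%E.
  by move=> Mk; apply: ereal_inf_lbound; exists k.
split=> [E|[Mn lt]].
  have min k : (M%:R%:E <= X k w)%E -> (n <= k)%N.
    by move=> /lb; rewrite E lee_fin ler_nat.
  split; last by move=> k kn; rewrite ltNge; apply/negP => /min; rewrite leqNgt kn.
  have : (exit_index X M w < n.+1%:R%:E)%E by rewrite E lte_fin ltr_nat.
  move=> /ereal_inf_lt[_ [k /= Mk <-]]; rewrite lte_fin ltr_nat ltnS => kn.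
  by have /eqP <- : k == n by rewrite eqn_leq kn min.
apply/eqP; rewrite eq_le; apply/andP; split; first exact: lb.
apply: le_ereal_inf_tmp => _ [k /= Mk <-]; rewrite lee_fin ler_nat leqNgt.
by apply/negP => /lt; rewrite ltNge Mk.
Qed.

Section exit_probability.
Context (d : measure_display) (T : measurableType d) (R : realType)
  (P : probability T R) (lambda mu a : R) (p : nat -> {RV P >-> R})
  (mark : nat -> {RV P >-> nat}) (F : R -> set (set T)) (tau : nat -> {RV P >-> R}).
Local Notation p_ := (fun k => p k : T -> R).
Local Notation mark_ := (fun k => mark k : T -> nat).
Local Notation A := (marked_process p_ mark_).
Hypotheses (lambda0 : 0 < lambda) (mu0 : 0 < mu) (a0 : 0 < a) (a1 : a < 1).
Hypotheses (mpp : marked_poisson_process lambda a p mark) (filF : filtration F)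
  (adF : adapted F A) (rtau : exponential_renewal mu tau)
  (indep : independent_systems P (sigma_generated (fun n => tau n : T -> R))
             <<s \bigcup_(s in [set s | 0 <= s]) F s >>).
Local Notation X := (fun n w => A (tau n w) w).
Local Notation D n := (fun w => tau n.+1 w - tau n w).

Let measurable_X n : measurable_fun setT (X n).
Proof. exact: (@measurable_marked_process _ _ _ p_ mark_ (tau n)). Qed.

Lemma measurable_exit_event M r t :
  measurable (exit_event X (fun n => tau n : T -> R) M r t).
Proof.
have mge n x : measurable [set w | (x <= X n w)%E].
  rewrite -[X in measurable X]setTI (_ : [set w | _] = X n @^-1` `[x, +oo[%classic).
    exact: measurable_X (emeasurable_itv _).
  by apply/seteqP; split => w /=; rewrite in_itv/= andbT.
rewrite (_ : exit_event _ _ _ _ _ = \bigcup_n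
  (([set w | (M%:R%:E <= X n w)%E] `&`
    \bigcap_(k in [set k | (k < n)%N]) ~` [set w | (M%:R%:E <= X k w)%E]) `&`
   (X n @^-1` [set r%:R%:E] `&` tau n.-1 @^-1` `]t, +oo[%classic))).
  apply: bigcupT_measurable => n; apply: measurableI.
    by apply: measurableI => //; apply: bigcap_measurableType => k _; exact: measurableC.
  apply: measurableI; rewrite -[X in measurable X]setTI.
    exact: measurable_X (emeasurable_set1 _).
  exact: (measurable_funP (tau n.-1) measurableT _ (measurable_itv _)).
apply/seteqP; split => w /=.
  move=> [n [/exit_indexP [Mn lt] Xr tn]]; exists n => //; split; last first.
    by split => //=; rewrite in_itv/= andbT.
  by split => // k /= kn; apply/negP; rewrite -ltNge; exact: lt.
move=> [n _ [[Mn lt] [Xr]]]; rewrite /= in_itv/= andbT => tn; exists n; split => //.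
by apply/exit_indexP; split => // k kn; rewrite ltNge; apply/negP; exact: lt.
Qed.

Lemma exit_event_small M r t : (r < M)%N ->
  exit_event X (fun n => tau n : T -> R) M r t = set0.
Proof.
move=> rM; apply/seteqP; split => // w [n [/exit_indexP [Mn _] Xr _]].
by move: Mn; rewrite Xr lee_fin ler_nat leqNgt rM.
Qed.

Definition positive_gaps : set T := \bigcap_n [set w | 0 < D n w].

Let measurable_gap n : measurable [set w | 0 < D n w].
Proof.
rewrite -[X in measurable X]setTI (_ : [set w | _] = (tau n.+1 \- tau n) @^-1` `]0, +oo[%classic).
  exact: (measurable_funB (measurable_funP (tau n.+1)) (measurable_funP (tau n))
    measurableT (measurable_itv _)).
by apply/seteqP; split => w /=; rewrite in_itv/= andbT.
Qed.

Lemma positive_gaps_as : P (~` positive_gaps) = 0%E.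
Proof.
apply: bigcap_null => // n; have [_ _ lD] := rtau.
rewrite (_ : ~` _ = (fun w => tau n.+1 w - tau n w) @^-1` `]-oo, 0]%classic); last first.
  by apply/seteqP; split => w /=; rewrite in_itv/= leNgt => /negP.
rewrite lD// /exponential_prob -integral_itv_bndo_bndc; last first.
  by apply/measurable_EFinP/measurable_funTS; exact: measurable_exponential_pdf.
apply: integral0_eq => x /=; rewrite in_itv/= => x0.
by rewrite lt0_exponential_pdf.
Qed.

Definition exit_step (M r : nat) (t : R) (n : nat) : set T :=
  [set w | exists2 j, (j < M)%N & two_step p mark t j r ((tau n w, D n w), w)].

Let measurable_step t j r n : 0 <= t ->
  measurable [set w | two_step p mark t j r ((tau n w, D n w), w)].
Proof.
move=> t0.
rewrite (_ : [set w | _] = tau n @^-1` `]t, +oo[%classic `&` [set w | 0 < D n w] `&`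
   (X n @^-1` [set j%:R%:E] `&` X n.+1 @^-1` [set r%:R%:E])).
  apply: measurableI; apply: measurableI => //; rewrite -[X in measurable X]setTI.
  - exact: (measurable_funP (tau n) measurableT _ (measurable_itv _)).
  - exact: measurable_X (emeasurable_set1 _).
  - exact: measurable_X (emeasurable_set1 _).
apply/seteqP; split => w /=; rewrite /two_step /= in_itv/= andbT (addrC (tau n w)) subrK.
  by move=> [].
by move=> [[? ?] [? ?]].
Qed.

Let tau_mono w : positive_gaps w -> forall m n, (m <= n)%N -> tau m w <= tau n w.
Proof.
move=> Gw m n /subnK <-; elim: (n - m)%N => // k IH.
by rewrite addSn (le_trans IH)// -subr_ge0 ltW//; exact: Gw.
Qed.

Let X_mono w : positive_gaps w -> forall m n, (m <= n)%N -> (X m w <= X n w)%E.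
Proof. by move=> Gw m n mn; apply: marked_process_le; exact: tau_mono. Qed.

Lemma exit_step_crossing M r t n w : (M <= r)%N -> exit_step M r t n w ->
  (X n w < M%:R%:E)%E /\ (M%:R%:E <= X n.+1 w)%E.
Proof.
move=> Mr [j jM [_ _ /= Xn]]; rewrite (addrC (tau _ w)) subrK => Xr.
by rewrite Xn Xr lte_fin lee_fin ltr_nat ler_nat.
Qed.

(** An exit index is at least 2 here: at index 0 or 1 the previous observation
    time is tau_0 = 0, which does not exceed t. *)
Lemma exit_event_steps M r t w : (0 < M)%N -> (M <= r)%N -> 0 <= t ->
  positive_marks mark w -> positive_gaps w ->
  exit_event X (fun n => tau n : T -> R) M r t w <->
  exists n, exit_step M r t n.+1 w.
Proof.
move=> M0 Mr t0 mw gw; have [tau0 _ _] := rtau; split.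
  move=> [[|n] [/exit_indexP [Mn lt] Xr /= tn]]; first by move: tn; rewrite tau0 ltNge t0.
  case: n => [|n] in Mn lt Xr tn *; first by move: tn; rewrite tau0 ltNge t0.
  exists n; have Xn := lt _ (ltnSn n.+1).
  have [k sk] : exists k, points_upto p_ w (tau n.+1 w) k.
    by apply: (marked_process_finite mpp mw); rewrite (lt_trans Xn) ?ltry.
  have XE := marked_process_upto mark_ sk.
  exists (\sum_(0 <= i < k) mark i w)%N.
    by move: Xn; rewrite XE lte_fin ltr_nat.
  split => //=; first exact: gw.
  by rewrite (addrC (tau _ w)) subrK.
move=> [n Sn]; have [Xn Mn] := exit_step_crossing Mr Sn.
move: Sn => [j jM [/= tn _ _]]; rewrite (addrC (tau _ w)) subrK => Xr.
exists n.+2; split => //; apply/exit_indexP; split => // k kn.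
by apply: le_lt_trans Xn; apply: X_mono.
Qed.

(** The steps are disjoint in n, because A(tau_n) crosses M only once, and
    renewal_measure sums their probabilities. *)
Lemma exit_event_prob M r t : (0 < M)%N -> (M <= r)%N -> 0 <= t ->
  P (exit_event X (fun n => tau n : T -> R) M r t) =
  (\sum_(j < M) occupation lambda mu a t j * gap_pmf lambda mu a (r - j))%:E.
Proof.
move=> M0 Mr t0.
have mE := measurable_exit_event M r t.
have m1 := measurable_positive_marks mark.
have n1 := positive_marks_as a0 a1 mpp.
have m2 : measurable positive_gaps by apply: bigcap_measurableType => n _; exact: measurable_gap.
have n2 := positive_gaps_as.
have mS n : measurable (exit_step M r t n).
  rewrite (_ : exit_step M r t n = \bigcup_(j in [set j | (j < M)%N])
      [set w | two_step p mark t j r ((tau n w, D n w), w)]).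
    by apply: bigcup_measurable => j _; exact: measurable_step.
  by apply/seteqP; split => w [j ? ?]; exists j.
pose G := positive_marks mark `&` positive_gaps.
have PG Z : measurable Z -> P (Z `&` G) = P Z.
  move=> mZ; rewrite setIA measureI_null//; last exact: measurableI.
  exact: measureI_null.
rewrite -(PG _ mE).
transitivity (P (\bigcup_n (exit_step M r t n.+1 `&` G))).
  congr (P _); apply/seteqP; split => w.
    move=> [Ew [mw gw]]; have [n Sn] := (exit_event_steps M0 Mr t0 mw gw).1 Ew.
    by exists n.
  move=> [n _ [Sn [mw gw]]]; split => //.
  by apply/(exit_event_steps M0 Mr t0 mw gw); exists n.
rewrite measure_semi_bigcup; last 3 first.
- by move=> n; apply: measurableI => //; exact: measurableI.
- move=> m n _ _ [w [[Sm [_ gw]] [Sn _]]].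
  have [Xm Mm] := exit_step_crossing Mr Sm; have [Xn Mn] := exit_step_crossing Mr Sn.
  apply/eqP; rewrite eqn_leq; apply/andP; split; rewrite leqNgt; apply/negP => mn.
    by move: Mn; rewrite leNgt => /negP; apply; apply: le_lt_trans Xm; exact: X_mono.
  by move: Mm; rewrite leNgt => /negP; apply; apply: le_lt_trans Xn; exact: X_mono.
- by apply: bigcupT_measurable => n; apply: measurableI => //; exact: measurableI.
have g0 j x : 0 <= ((cp_pmf lambda a ^~ j) \_ `]t, +oo[) x.
  exact: cp_pmf_after_ge0.
have stepP n : P (exit_step M r t n.+1 `&` G) = (\sum_(j < M)
    renewal_mean mu n.+1 (EFin \o ((cp_pmf lambda a ^~ j) \_ `]t, +oo[)) *
    (gap_pmf lambda mu a (r - j))%:E)%E.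
  rewrite PG// /exit_step measure_ord_bigcup; last 2 first.
  - by move=> j; exact: measurable_step.
  - move=> i j w [_ _ /= Xi _] [_ _ /= Xj _]; apply/eqP; rewrite -(eqr_nat R).
    by move: Xi; rewrite Xj => -[->].
  apply: eq_bigr => j _; apply: (two_step_law lambda0 mu0 a0 a1 mpp filF adF rtau indep) => //.
  by rewrite (leq_trans _ Mr)// ltnW.
rewrite (eq_eseriesr (fun n _ => stepP n)).
have gap0 m : (0 <= (gap_pmf lambda mu a m)%:E)%E.
  by rewrite lee_fin gap_pmf_ge0.
have rm0 n f : (forall x, (0 <= f x)%E) -> (0 <= renewal_mean mu n f)%E.
  by elim: n f => [|n IH] f f0 //=; apply: IH => x; exact: expo_step_ge0.
rewrite nneseries_sum; last first.
  move=> j n _; apply: mule_ge0; last exact: gap0.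
  by apply: rm0 => x; rewrite lee_fin; exact: g0.
rewrite -sumEFin; apply: eq_bigr => j _.
under eq_eseriesr do rewrite muleC.
rewrite nneseriesZl; last by move=> n _; apply: rm0 => x; rewrite lee_fin; exact: g0.
rewrite renewal_measure//; last first.
  exact: measurable_cp_pmf_after.
by rewrite (occupationE mu lambda0 a0 a1)// -EFinM mulrC.
Qed.

End exit_probability.

(** * The coefficients R, G and H *)

(** The sum over the number k of marks weighted by x^k, an instance of the binomial
    theorem. It is used at x = lambda / (lambda + mu), where 1 - a + a x = c and
    a x = c - b, and at x = 1. *)
Lemma negbin_pgf (R : realType) (a x : R) m :
  \sum_(k < m.+2) negbin a k m.+1 * x ^+ k = a * x * (1 - a + a * x) ^+ m.
Proof.
rewrite big_ord_recl/= mul0r add0r exprDn mulr_sumr; apply: eq_bigr => k _.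
rewrite /bump/= ?add1n subSS exprMn !exprS -mulr_natl; ring.
Qed.

Section coefficients.
Context (R : realType) (lambda mu a t : R).
Hypotheses (lambda0 : 0 < lambda) (mu0 : 0 < mu) (a0 : 0 < a) (a1 : a < 1) (t0 : 0 <= t).
Local Notation b := (1 - a).
Local Notation c := (coef_c lambda mu a).

Let b0 : b != 0. Proof. by rewrite gt_eqF// subr_gt0. Qed.
Let l0 : lambda != 0. Proof. by rewrite gt_eqF. Qed.
Let ml0 : mu + lambda != 0. Proof. by rewrite gt_eqF// addr_gt0. Qed.

Lemma gap_pmf_coef_R j r : (j <= r)%N ->
  gap_pmf lambda mu a (r - j) = mu / (mu + lambda) * coef_R lambda mu a j r.
Proof.
move=> jr; rewrite /gap_pmf /coef_R ltnNge jr/= (addrC lambda).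
have [->|rj] := eqVneq r j.
  by rewrite subnn big_ord1 expr0 !mulr1.
congr (_ * _); have : (0 < r - j)%N by rewrite subn_gt0 ltn_neqAle eq_sym rj.
case: (r - j)%N => // m _; rewrite negbin_pgf subn1/=.
by congr (_ * _ ^+ _); rewrite /coef_c; field.
Qed.

Lemma occupation_reg_lower_gamma j :
  occupation lambda mu a t j = mu / lambda *
    \sum_(k < j.+1) negbin a k j * (1 - reg_lower_gamma k.+1 (lambda * t)).
Proof.
congr (_ * _); apply: eq_bigr => k _; rewrite reg_lower_gammaE//.
by congr (_ * _); rewrite opprB addrCA subrr addr0.
Qed.

Lemma occupation0 :
  occupation lambda mu a t 0 = (mu + lambda) / lambda - coef_G lambda mu a t 0.
Proof.
rewrite occupation_reg_lower_gamma big_ord1 /coef_G big_nat1 bin0 !expr0 !mul1r.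
rewrite [reg_lower_gamma 0 _]/=; move: (reg_lower_gamma 1 _) => x.
by rewrite /negbin /=; field.
Qed.

(** Pascal's rule turns the binomial weights of size i + 1 into those of size i, once
    with the index k kept and once with k shifted; the shifted part with weight
    a / b accounts for the additional term in the second sum. *)
Lemma binomial_mixture_diff (f : nat -> R) (x : R) i :
  b ^+ i.+1 * (\sum_(0 <= k < i.+2) 'C(i.+1, k)%:R * (a / b) ^+ k * (f k + x * f k.+1)) -
  b ^+ i.+1 * (\sum_(0 <= k < i.+1) 'C(i, k)%:R * (a / b) ^+ k *
      (f k + (x + a / b) * f k.+1)) =
  x * \sum_(k < i.+2) negbin a k i.+1 * f k.+1.
Proof.
pose h k := f k + x * f k.+1.
pose u k := a ^+ k * b ^+ (i.+1 - k).
have uE k : (k <= i.+1)%N -> b ^+ i.+1 * (a / b) ^+ k = u k.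
  move=> ki; rewrite /u -{1}(subnK ki) exprD exprMn exprVn.
  by have := expf_neq0 k b0; move=> bk; field.
have GE : b ^+ i.+1 * \sum_(0 <= k < i.+2) 'C(i.+1, k)%:R * (a / b) ^+ k * h k =
    u 0%N * h 0%N + \sum_(k < i.+1) ('C(i, k.+1)%:R + 'C(i, k)%:R) * u k.+1 * h k.+1.
  rewrite big_mkord big_ord_recl mulrDr; congr (_ + _).
    by rewrite bin0 mul1r mulrA uE.
  rewrite mulr_sumr; apply: eq_bigr => k _.
  by rewrite /bump/= ?add1n binS natrD -uE ?ltn_ord//; ring.
have HE : b ^+ i.+1 * \sum_(0 <= k < i.+1) 'C(i, k)%:R * (a / b) ^+ k *
      (f k + (x + a / b) * f k.+1) =
    u 0%N * h 0%N + \sum_(k < i.+1) 'C(i, k.+1)%:R * u k.+1 * h k.+1 +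
    \sum_(k < i.+1) 'C(i, k)%:R * u k.+1 * f k.+1.
  rewrite [X in _ = _ + X + _]big_ord_recr/= bin_small// !mul0r addr0.
  transitivity (\sum_(k < i.+1) 'C(i, k)%:R * u k * h k +
      \sum_(k < i.+1) 'C(i, k)%:R * u k.+1 * f k.+1).
    rewrite big_mkord mulr_sumr -big_split/=; apply: eq_bigr => k _.
    rewrite -(uE k) 1?ltnW// -(uE k.+1) ?ltn_ord// /h [(a / b) ^+ k.+1]exprS.
    move: (a / b) (b ^+ i.+1) => y B. ring.
  by congr (_ + _); rewrite big_ord_recl bin0 mul1r.
rewrite GE HE [RHS]mulr_sumr [RHS]big_ord_recl/= mul0r mulr0 add0r.
transitivity (\sum_(k < i.+1) 'C(i, k)%:R * u k.+1 * h k.+1 -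
              \sum_(k < i.+1) 'C(i, k)%:R * u k.+1 * f k.+1).
  under eq_bigr do rewrite !mulrDl.
  by rewrite big_split/=; ring.
rewrite -sumrB; apply: eq_bigr => k _.
by rewrite /bump/= ?add1n /h /u subSS; ring.
Qed.

Lemma coef_GH i : coef_G lambda mu a t i.+1 - coef_H lambda mu a t i =
  mu / lambda * \sum_(k < i.+2) negbin a k i.+1 * reg_lower_gamma k.+1 (lambda * t).
Proof. exact: (binomial_mixture_diff (fun k => reg_lower_gamma k (lambda * t))). Qed.

Lemma occupationS i : occupation lambda mu a t i.+1 =
  mu / lambda * a - (coef_G lambda mu a t i.+1 - coef_H lambda mu a t i).
Proof.
rewrite coef_GH occupation_reg_lower_gamma -mulrBr; congr (_ * _).
transitivity (\sum_(k < i.+2) negbin a k i.+1 * 1 ^+ k -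
   \sum_(k < i.+2) negbin a k i.+1 * reg_lower_gamma k.+1 (lambda * t)).
  by rewrite -sumrB; apply: eq_bigr => k _; rewrite expr1n mulrBr.
by rewrite negbin_pgf mulr1 subrK expr1n mulr1.
Qed.

End coefficients.

(** * Truncated power series *)

Section geometric_convolution.
Context (R : realType) (c : R) (r : nat).

(** The coefficient of z^r in z^s w(z) / (1 - c z). It is 0 when s > r because
    the range of the sum is then empty. *)
Definition geo_conv (w : nat -> R) (s : nat) : R :=
  \sum_(j < r.+1 - s) w j * c ^+ (r - (j + s)).

Lemma geo_conv_split w w' s :
  geo_conv (fun j => w j + w' j) s = geo_conv w s + geo_conv w' s.
Proof. by rewrite -big_split; apply: eq_bigr => j _; rewrite mulrDl. Qed.

Lemma sum_indic (K x : nat) :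
  \sum_(0 <= i < K) c ^+ i * (r == i + x)%N%:R =
  if ((x <= r) && (r - x < K))%N then c ^+ (r - x) else 0 :> R.
Proof.
case: ifPn => [/andP[xr rK]|H].
  rewrite (bigD1_seq (r - x)%N) ?mem_index_iota ?iota_uniq//= subnK// eqxx mulr1.
  rewrite big1 ?addr0// => i ix; case: eqP => [ri|]; last by rewrite mulr0.
  by rewrite ri addnK eqxx in ix.
rewrite big1_seq// => i; rewrite mem_index_iota/= => iK.
case: eqP => [ri|]; last by rewrite mulr0.
by move: H; rewrite ri leq_addl addnK iK.
Qed.

Lemma sum_geo_conv (w : nat -> R) M s : (r < M)%N ->
  \sum_(0 <= j < M - s) w j * (if (j + s <= r)%N then c ^+ (r - (j + s)) else 0) =
  geo_conv w s.
Proof.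
move=> rM; have rs : (r.+1 - s <= M - s)%N by rewrite leq_sub2r.
rewrite (big_cat_nat (leq0n _) rs)/= [X in _ + X]big1_seq ?addr0; last first.
  move=> j; rewrite mem_index_iota/= => /andP[rj jM].
  by rewrite ifN ?mulr0// -ltnNge; lia.
rewrite big_mkord; apply: eq_bigr => j _; rewrite ifT//; have := ltn_ord j; lia.
Qed.

(** The truncation bounds j + i + s by M - 1 and has no effect on the coefficient of
    z^r when r < M. *)
Lemma truncated_bracket (w : nat -> R) M s : (r < M)%N ->
  \sum_(0 <= j < M - s) w j *
    (\sum_(0 <= i < M - s - j) c ^+ i * (r == i + (j + s))%N%:R) =
  geo_conv w s.
Proof.
move=> rM; rewrite -(sum_geo_conv w s rM); apply: eq_big_nat => j /= jM.
rewrite sum_indic; congr (_ * _); case: ifPn => [/andP[-> _]//|H].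
by case: ifPn => // js; move: H; rewrite js/= => /negP; case; lia.
Qed.

Lemma truncated_bracket0 (w : nat -> R) M s : (M <= r)%N ->
  \sum_(0 <= j < M - s) w j *
    (\sum_(0 <= i < M - s - j) c ^+ i * (r == i + (j + s))%N%:R) = 0.
Proof.
move=> Mr; apply: big1_seq => j; rewrite mem_index_iota/= => jM.
rewrite sum_indic ifN ?mulr0//; apply/negP; lia.
Qed.

Lemma geo_convS w s : (s <= r)%N ->
  geo_conv w s = w (r - s)%N + c * geo_conv w s.+1.
Proof.
move=> sr; rewrite /geo_conv subSn// subSS big_ord_recr/= subnK// subnn mulr1 addrC.
congr (_ + _); rewrite mulr_sumr; apply: eq_bigr => j _; have := ltn_ord j => jr.
rewrite (_ : (r - (j + s) = (r - (j + s.+1)).+1)%N); last by lia.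
by rewrite exprS; ring.
Qed.

Lemma geo_conv_shift w v s : w 0%N = 0 -> (forall j, w j.+1 = v j) ->
  geo_conv w s = geo_conv v s.+1.
Proof.
move=> w0 wS; rewrite /geo_conv subSS; have [rs|sr] := ltnP r s.
  have -> : (r.+1 - s = 0)%N by apply/eqP; rewrite subn_eq0.
  have -> : (r - s = 0)%N by apply/eqP; rewrite subn_eq0 ltnW.
  by rewrite !big_ord0.
rewrite subSn// big_ord_recl w0 mul0r add0r; apply: eq_bigr => j _.
by rewrite /bump/= ?add1n wS addSnnS.
Qed.

End geometric_convolution.

Lemma geo_conv_out (R : realType) (c : R) r w s : (r < s)%N -> geo_conv c r w s = 0.
Proof.
move=> rs; rewrite /geo_conv; have -> : (r.+1 - s = 0)%N by apply/eqP; rewrite subn_eq0.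
by rewrite big_ord0.
Qed.

(** As power series, (1 - c) v(z) = (1 - c z) / (1 - z): all the coefficients of
    (1 - c) v(z) / (1 - c z) are 1. *)
Lemma geo_conv_stationary (R : realType) (c : R) r (v : nat -> R) s :
  (1 - c) * v 0%N = 1 -> (forall j, v j.+1 = 1) -> (s <= r)%N ->
  (1 - c) * geo_conv c r v s = 1.
Proof.
move=> v0 vS sr; rewrite -(subKn sr); move: (r - s)%N (leq_subr s r) => {sr} n.
elim: n => [|n IH] nr.
  by rewrite subn0 geo_convS// subnn geo_conv_out// mulr0 addr0.
have -> : geo_conv c r v (r - n.+1) = 1 + c * geo_conv c r v (r - n).
  by rewrite geo_convS ?leq_subr// subKn// vS subnSK.
rewrite mulrDr mulr1 [(1 - c) * (c * _)]mulrCA IH ?mulr1 ?subrK//.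
exact: ltnW.
Qed.

(** The numbers R_jr are the coefficients of z^j (1 - b z) / (1 - c z). *)
Lemma sum_coef_R (R : realType) (lambda mu a : R) (w : nat -> R) M r : (r < M)%N ->
  \sum_(0 <= j < M) w j * coef_R lambda mu a j r =
  geo_conv (coef_c lambda mu a) r w 0 - (1 - a) * geo_conv (coef_c lambda mu a) r w 1.
Proof.
move=> rM; rewrite -(sum_geo_conv _ w 0 rM) -(sum_geo_conv _ w 1 rM) subn0.
rewrite mulr_sumr.
rewrite [X in _ = _ - X](_ : _ = \sum_(0 <= j < M) (1 - a) *
   (w j * (if (j + 1 <= r)%N then coef_c lambda mu a ^+ (r - (j + 1)) else 0))); last first.
  have M0 : (0 < M)%N by apply: leq_ltn_trans rM.
  rewrite -{2}(prednK M0) big_nat_recr//= [X in _ = _ + X](_ : _ = 0) ?addr0 ?subn1//.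
  by rewrite ifN ?mulr0// -ltnNge addn1 prednK.
rewrite -sumrB; apply: eq_bigr => j _; rewrite /coef_R addn0 addn1.
have [rj|jr|->] := ltngtP r j.
- by rewrite !mulr0 subr0.
- rewrite (_ : (r - j = (r - j.+1).+1)%N); last by lia.
  by rewrite subn1/= exprS; ring.
- by rewrite subnn expr0 !mulr0 subr0.
Qed.

(** * The closed formula *)

Section formula.
Context (R : realType) (lambda mu a t : R) (M r : nat).
Hypotheses (lambda0 : 0 < lambda) (mu0 : 0 < mu) (a0 : 0 < a) (a1 : a < 1)
  (M0 : (0 < M)%N) (t0 : 0 <= t).
Local Notation b := (1 - a).
Local Notation c := (coef_c lambda mu a).
Local Notation R_ j := (coef_R lambda mu a j r).
Local Notation G := (coef_G lambda mu a t).
Local Notation H := (coef_H lambda mu a t).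

Definition passage_main : R :=
  mu / lambda * (a * mu / (mu + lambda))
     * ((mu + lambda) / (a * mu) * R_ 0%N + \sum_(1 <= j < M) R_ j)
   - mu / (mu + lambda)
     * (G 0%N * R_ 0%N + \sum_(1 <= j < M) (G j - H j.-1) * R_ j).

Definition passage_bracket1 : R :=
  \sum_(0 <= j < M) \sum_(0 <= i < M - j) c ^+ i * (r == i + j)%N%:R
  - (b + c) * (\sum_(0 <= j < M - 1) \sum_(0 <= i < M - 1 - j)
            c ^+ i * (r == i + j + 1)%N%:R)
  + b * c * (\sum_(0 <= j < M - 2) \sum_(0 <= i < M - 2 - j)
            c ^+ i * (r == i + j + 2)%N%:R).

Definition passage_bracket2 : R :=
  \sum_(0 <= j < M) G j * (\sum_(0 <= i < M - j) c ^+ i * (r == i + j)%N%:R)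
  - \sum_(0 <= j < M - 1) (b * G j + H j) * (\sum_(0 <= i < M - 1 - j)
            c ^+ i * (r == i + j + 1)%N%:R)
  + b * (\sum_(0 <= j < M - 2) H j * (\sum_(0 <= i < M - 2 - j)
            c ^+ i * (r == i + j + 2)%N%:R)).

Let bracket (w : nat -> R) s := \sum_(0 <= j < M - s) w j *
  (\sum_(0 <= i < M - s - j) c ^+ i * (r == i + (j + s))%N%:R).

Let bracket1E : passage_bracket1 = bracket (fun=> 1) 0 -
  (b + c) * bracket (fun=> 1) 1 + b * c * bracket (fun=> 1) 2.
Proof.
rewrite /passage_bracket1 /bracket subn0.
congr (_ - _ * _ + _ * _); apply: eq_bigr => j _; rewrite mul1r; apply: eq_bigr => i _.
- by rewrite addn0.
- by rewrite addnA.
- by rewrite addnA.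
Qed.

Let bracket2E : passage_bracket2 = bracket G 0 -
  bracket (fun j => b * G j + H j) 1 + b * bracket H 2.
Proof.
rewrite /passage_bracket2 /bracket subn0.
congr (_ - _ + _ * _); apply: eq_bigr => j _; congr (_ * _); apply: eq_bigr => i _.
- by rewrite addn0.
- by rewrite addnA.
- by rewrite addnA.
Qed.

Lemma passage_main_large : (M <= r)%N -> passage_main =
  \sum_(j < M) occupation lambda mu a t j * gap_pmf lambda mu a (r - j).
Proof.
move=> Mr; rewrite -(big_mkord xpredT
  (fun j => occupation lambda mu a t j * gap_pmf lambda mu a (r - j))).
rewrite big_ltn//= subn0 /passage_main.
rewrite [X in _ = _ + X](eq_big_nat _ _ (F2 := fun j =>
   mu / lambda * (a * mu / (mu + lambda)) * R_ j -
   mu / (mu + lambda) * ((G j - H j.-1) * R_ j))); last first.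
  case=> // j /andP[_ jM]; rewrite occupationS// gap_pmf_coef_R//; last by lia.
  by rewrite /=; ring.
rewrite sumrB -!mulr_sumr -[X in gap_pmf _ _ _ X](subn0 r) gap_pmf_coef_R//.
rewrite occupation0//.
have l0 : lambda != 0 by rewrite gt_eqF.
have m0 : mu != 0 by rewrite gt_eqF.
have aa0 : a != 0 by rewrite gt_eqF.
have ml0 : mu + lambda != 0 by rewrite gt_eqF// addr_gt0.
by field; rewrite ?l0 ?m0 ?aa0 ?ml0.
Qed.

Lemma passage_brackets_large : (M <= r)%N ->
  passage_bracket1 = 0 /\ passage_bracket2 = 0.
Proof.
move=> Mr; rewrite bracket1E bracket2E /bracket !truncated_bracket0//.
by split; ring.
Qed.

(** The terms in G and H cancel coefficientwise, both being
    (G(z) - z H(z)) (1 - b z) / (1 - c z). The remaining two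
    terms are both the coefficient of (1 - b z) / (1 - z): the first one since
    c = 1 - a mu / (mu + lambda), the bracket since its factor
    (1 - b z) (1 - c z) / (1 - c z) simplifies. *)
Lemma passage_small : (r < M)%N ->
  passage_main - mu / lambda * passage_bracket1 +
    mu / (mu + lambda) * passage_bracket2 = 0.
Proof.
move=> rM; rewrite bracket1E bracket2E /bracket !truncated_bracket//.
pose v j : R := if j is 0 then (mu + lambda) / (a * mu) else 1.
pose w j : R := if j is k.+1 then G j - H k else G 0%N.
rewrite /passage_main.
have -> : (mu + lambda) / (a * mu) * R_ 0%N + \sum_(1 <= j < M) R_ j =
    \sum_(0 <= j < M) v j * R_ j.
  by rewrite [RHS]big_ltn//; congr (_ + _); apply: eq_big_nat => -[|j] //= _; rewrite mul1r.
have -> : G 0%N * R_ 0%N + \sum_(1 <= j < M) (G j - H j.-1) * R_ j =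
    \sum_(0 <= j < M) w j * R_ j.
  by rewrite [RHS]big_ltn//; congr (_ + _); apply: eq_big_nat => -[|j].
rewrite !sum_coef_R//.
pose w' j : R := if j is k.+1 then - H k else 0.
have wE s : geo_conv c r w s = geo_conv c r G s - geo_conv c r H s.+1.
  transitivity (geo_conv c r (fun j => G j + w' j) s).
    by apply: eq_bigr => -[[|j] jr] _ //=; rewrite addr0.
  rewrite geo_conv_split [X in _ + X](geo_conv_shift _ _ (v := fun j => - H j))//.
  by congr (_ + _); rewrite /geo_conv -sumrN; apply: eq_bigr => j _; rewrite mulNr.
rewrite !wE.
have -> : geo_conv c r (fun j => b * G j + H j) 1 =
    b * geo_conv c r G 1 + geo_conv c r H 1.
  rewrite geo_conv_split; congr (_ + _).
  by rewrite /geo_conv mulr_sumr; apply: eq_bigr => j _; rewrite [RHS]mulrA.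
have l0 : lambda != 0 by rewrite gt_eqF.
have m0 : mu != 0 by rewrite gt_eqF.
have aa0 : a != 0 by rewrite gt_eqF.
have ml0 : mu + lambda != 0 by rewrite gt_eqF// addr_gt0.
(* The prefactor of the first term is 1 - c, which makes geo_conv_stationary applicable. *)
have cE : a * mu / (mu + lambda) = 1 - c by rewrite /coef_c; field.
have v0 : (1 - c) * v 0%N = 1 by rewrite -cE /v; field; rewrite m0 aa0 ml0.
have V s := geo_conv_stationary v0 (fun=> erefl) (s := s) (r := r).
rewrite cE.
(* geo_convS unrolls the geometric sums down to their last term. *)
have E0 := @geo_convS _ c r (fun=> 1) 0 (leq0n r).
have V0 := V 0%N (leq0n r).
have [r0|r_gt0] := posnP r.
  have out u s : geo_conv c r u s.+1 = 0 by apply: geo_conv_out; rewrite r0.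
  rewrite (out v) E0 !(out (fun=> 1)) mulr0 subr0 -(mulrA (mu / lambda)) V0.
  ring.
have E1 := @geo_convS _ c r (fun=> 1) 1 r_gt0.
have V1 := V 1%N r_gt0.
rewrite E0 E1.
rewrite -(mulrA (mu / lambda)) (mulrBr (1 - c)) V0 (mulrCA (1 - c)) V1.
ring.
Qed.

End formula.

Theorem proposition4p3 (d : measure_display) (T : measurableType d)
    (R : realType) (P : probability T R) (lambda mu a : R)
    (p : nat -> {RV P >-> R}) (mark : nat -> {RV P >-> nat})
    (F : R -> set (set T)) (tau : nat -> {RV P >-> R})
    (M r : nat) (t : R) :
  let A := marked_process (fun k => p k : T -> R) (fun k => mark k : T -> nat) in
  let A_ (n : nat) (w : T) := A (tau n w) w in
  let b := 1 - a in
  let c := coef_c lambda mu a in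
  let R_ j := coef_R lambda mu a j r in
  let G := coef_G lambda mu a t in
  let H := coef_H lambda mu a t in
  0 < lambda -> 0 < mu -> 0 < a -> a < 1 -> (0 < M)%N -> 0 <= t ->
  marked_poisson_process lambda a p mark ->
  filtration F -> adapted F A ->
  exponential_renewal mu tau ->
  independent_systems P (sigma_generated (fun n => tau n : T -> R))
    <<s \bigcup_(s in [set s | 0 <= s]) F s >> ->
  P (exit_event A_ (fun n => tau n : T -> R) M r t) =
  (mu / lambda * (a * mu / (mu + lambda))
     * ((mu + lambda) / (a * mu) * R_ 0%N + \sum_(1 <= j < M) R_ j)
   - mu / (mu + lambda)
     * (G 0%N * R_ 0%N + \sum_(1 <= j < M) (G j - H j.-1) * R_ j)
   - mu / lambda
     * (\sum_(0 <= j < M) \sum_(0 <= i < M - j)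
            c ^+ i * (r == i + j)%N%:R
        - (b + c) * (\sum_(0 <= j < M - 1) \sum_(0 <= i < M - 1 - j)
            c ^+ i * (r == i + j + 1)%N%:R)
        + b * c * (\sum_(0 <= j < M - 2) \sum_(0 <= i < M - 2 - j)
            c ^+ i * (r == i + j + 2)%N%:R))
   + mu / (mu + lambda)
     * (\sum_(0 <= j < M) G j * (\sum_(0 <= i < M - j)
            c ^+ i * (r == i + j)%N%:R)
        - \sum_(0 <= j < M - 1) (b * G j + H j) * (\sum_(0 <= i < M - 1 - j)
            c ^+ i * (r == i + j + 1)%N%:R)
        + b * (\sum_(0 <= j < M - 2) H j * (\sum_(0 <= i < M - 2 - j)
            c ^+ i * (r == i + j + 2)%N%:R))))%:E.
Proof.
move=> A A_ b c R_ G H lambda0 mu0 a0 a1 M0 t0 mpp filF adF rtau indep.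
transitivity ((passage_main lambda mu a t M r -
  mu / lambda * passage_bracket1 lambda mu a M r +
  mu / (mu + lambda) * passage_bracket2 lambda mu a t M r)%:E); last by [].
have [rM|Mr] := ltnP r M.
  by rewrite passage_small// exit_event_small// measure0.
have [-> ->] := passage_brackets_large lambda mu a t Mr.
rewrite !mulr0 subr0 addr0 passage_main_large//.
exact: (exit_event_prob lambda0 mu0 a0 a1 mpp filF adF rtau indep).
Qed.
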